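(* Suppose there is a constant $C_2$, independent of $\alpha$ and $\beta$, such that for all $\alpha,\beta>-1$ and all $f\in L^2([-1,1],\mu_{\alpha,\beta})$ the Jacobi-Riesz transform satisfies $$\|R^{\alpha,\beta}f\|_{L^2(\mu_{\alpha,\beta})}\le C_2\,\|f\|_{L^2(\mu_{\alpha,\beta})}.$$ Then: (i) the Gaussian-Riesz transform satisfies $\|R^{\gamma}f\|_{L^2(\gamma)}\le C_2\,\|f\|_{L^2(\gamma)}$ for all $f\in L^2(\mathbb{R},\gamma)$; and (ii) for every $\alpha>-1$, the Laguerre-Riesz transform satisfies $\|R^{\alpha}f\|_{L^2(\mu_\alpha)}\le C_2\,\|f\|_{L^2(\mu_\alpha)}$ for all $f\in L^2((0,\infty),\mu_\alpha)$.
   Context: Measures. For $\alpha,\beta>-1$, the Jacobi measure is the probability measure on $(-1,1)$ $$\mu_{\alpha,\beta}(dx)=\frac{\Gamma(\alpha+\beta+2)}{2^{\alpha+\beta+1}\Gamma(\alpha+1)\Gamma(\beta+1)}(1-x)^\alpha(1+x)^\beta\,dx .$$ The Gaussian measure on $\mathbb{R}$ is $\gamma(dx)=\frac{e^{-x^2}}{\sqrt\pi}dx$. For $\alpha>-1$, the Gamma measure on $(0,\infty)$ is $\mu_\alpha(dx)=\frac{x^\alpha e^{-x}}{\Gamma(\alpha+1)}dx$. In each space $L^2(\mu)$ write $\langle f,g\rangle=\int f g\,d\mu$ for the relevant measure $\mu$. Polynomials (Szegő's normalizations). Jacobi: $P_n^{(\alpha,\beta)}(x)=\frac{(-1)^n}{2^n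 n!}(1-x)^{-\alpha}(1+x)^{-\beta}\frac{d^n}{dx^n}\left[(1-x)^{n+\alpha}(1+x)^{n+\beta}\right]$. Hermite: $H_n(x)=(-1)^n e^{x^2}\frac{d^n}{dx^n}e^{-x^2}$. Laguerre: $L_n^\alpha(x)=\frac{1}{n!}x^{-\alpha}e^{x}\frac{d^n}{dx^n}\left(e^{-x}x^{n+\alpha}\right)$. These are orthogonal in $L^2(\mu_{\alpha,\beta})$, $L^2(\gamma)$, $L^2(\mu_\alpha)$ respectively. Put $\hat h_n^{(\alpha,\beta)}=\|P_n^{(\alpha,\beta)}\|^2_{L^2(\mu_{\alpha,\beta})}$. Riesz transforms (defined on $L^2$ by the following series). Jacobi: with $\lambda_k=k(k+\alpha+\beta+1)$, $$R^{\alpha,\beta}f(x)=\sum_{k=1}^\infty \frac{\langle f,P_k^{(\alpha,\beta)}\rangle}{\hat h_k^{(\alpha,\beta)}}\,\lambda_k^{-1/2}\,\frac{k+\alpha+\beta+1}{2}\,\sqrt{1-x^2}\,P_{k-1}^{(\alpha+1,\beta+1)}(x).$$ Gaussian: $$R^\gamma f(x)=\sum_{k=1}^\infty\frac{\langle f,H_k\rangle}{2^k k!}\sqrt{2k}\,H_{k-1}(x).$$ Laguerre: $$R^\alpha f(x)=-\sum_{k=1}^\infty\frac{\Gamma(\alpha+1)\,k!}{\Gamma(k+\alpha+1)}\,\frac{1}{\sqrt k}\,\langle f,L_k^\alpha\rangle\,\sqrt{x}\,L_{k-1}^{\alpha+1}(x).$$ *)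

(* Defs.v *)
From HB Require Import structures.
From mathcomp Require Import all_boot all_order all_algebra.
From mathcomp Require Import all_classical all_reals all_analysis.
From mathcomp Require Import measurable_realfun.

Set Implicit Arguments.
Unset Strict Implicit.
Unset Printing Implicit Defensive.
Import Order.TTheory GRing.Theory Num.Theory.
Import numFieldNormedType.Exports.

Local Open Scope classical_set_scope.
Local Open Scope ring_scope.

(* Euler's integral; only meaningful for 0 < s. *)
Definition Gamma {R : realType} (s : R) : R :=
  \int[lebesgue_measure]_(t in `]0, +oo[) (t `^ (s - 1) * expR (- t)).

Lemma Gamma_ge0 {R : realType} (s : R) : 0 <= Gamma s.
Proof.
apply: Rintegral_ge0 => t _.
by rewrite mulr_ge0 ?powR_ge0 ?expR_ge0.
Qed.

(* The measures live on the whole line, with densities vanishing outside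
   (-1, 1), resp. (0, +oo). *)
Definition jacobi_pdf {R : realType} (a b x : R) : R :=
  \1_(`]-1, 1[ : set R) x *
  (Gamma (a + b + 2) / (2 `^ (a + b + 1) * Gamma (a + 1) * Gamma (b + 1)) *
   (1 - x) `^ a * (1 + x) `^ b).

Definition gauss_pdf {R : realType} (x : R) : R :=
  expR (- x ^+ 2) / Num.sqrt pi.

Definition laguerre_pdf {R : realType} (a x : R) : R :=
  \1_(`]0, +oo[ : set R) x * (x `^ a * expR (- x) / Gamma (a + 1)).

Definition density_measure {R : realType} (w : R -> R) :
    set (measurableTypeR R) -> \bar R :=
  fun V => (\int[lebesgue_measure]_(x in V) (w x)%:E)%E.

Definition jacobi_measure {R : realType} (a b : R) :
    set (measurableTypeR R) -> \bar R :=
  density_measure (jacobi_pdf a b).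

Definition gauss_measure (R : realType) :
    set (measurableTypeR R) -> \bar R :=
  density_measure (@gauss_pdf R).
Arguments gauss_measure R : clear implicits.

Definition laguerre_measure {R : realType} (a : R) :
    set (measurableTypeR R) -> \bar R :=
  density_measure (laguerre_pdf a).

Lemma density_measure0 {R : realType} (w : R -> R) :
  density_measure w set0 = 0%E.
Proof. by rewrite /density_measure integral_set0. Qed.

Lemma density_measure_ge0 {R : realType} (w : R -> R)
    (w0 : forall x, 0 <= w x) V : (0 <= density_measure w V)%E.
Proof. by apply: integral_ge0 => x _; rewrite lee_fin. Qed.

Lemma density_measure_sigma_additive {R : realType} (w : R -> R)
    (mw : measurable_fun [set: R] w) (w0 : forall x, 0 <= w x) :
  semi_sigma_additive (density_measure w).
Proof.
move=> F mF tF mUF; rewrite /density_measure ge0_integral_bigcup//=.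
- apply: is_cvg_ereal_nneg_natsum_cond => n _ _.
  by apply: integral_ge0 => x _; rewrite lee_fin.
- by apply/measurable_EFinP; exact: measurable_funTS.
- by move=> x _; rewrite lee_fin.
Qed.

Section measures.
Context {R : realType}.
Variables a b : R.

Lemma measurable_jacobi_pdf : measurable_fun [set: R] (jacobi_pdf a b).
Proof.
apply: measurable_funM; first exact: measurable_indic.
apply: measurable_funM; first apply: measurable_funM => //.
  by apply: measurableT_comp (measurable_powR a) _; exact: measurable_funB.
by apply: measurableT_comp (measurable_powR b) _; exact: measurable_funD.
Qed.

Lemma jacobi_pdf_ge0 x : 0 <= jacobi_pdf a b x.
Proof. by rewrite /jacobi_pdf !(mulr_ge0, invr_ge0, powR_ge0, Gamma_ge0). Qed.

HB.instance Definition _ := isMeasure.Build _ _ _ (jacobi_measure a b)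
  (density_measure0 (jacobi_pdf a b)) (density_measure_ge0 jacobi_pdf_ge0)
  (density_measure_sigma_additive measurable_jacobi_pdf jacobi_pdf_ge0).

Lemma measurable_gauss_pdf : measurable_fun [set: R] (@gauss_pdf R).
Proof.
apply: measurable_funM => //; apply: measurableT_comp => //.
by apply: measurableT_comp => //; exact: measurable_funX.
Qed.

Lemma gauss_pdf_ge0 (x : R) : 0 <= gauss_pdf x.
Proof. by rewrite /gauss_pdf divr_ge0 ?expR_ge0 ?sqrtr_ge0. Qed.

HB.instance Definition _ := isMeasure.Build _ _ _ (gauss_measure R)
  (density_measure0 (@gauss_pdf R)) (density_measure_ge0 gauss_pdf_ge0)
  (density_measure_sigma_additive measurable_gauss_pdf gauss_pdf_ge0).

Lemma measurable_laguerre_pdf : measurable_fun [set: R] (laguerre_pdf a).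
Proof.
apply: measurable_funM; first exact: measurable_indic.
apply: measurable_funM => //; apply: measurable_funM.
  exact: measurable_powR.
by apply: measurableT_comp.
Qed.

Lemma laguerre_pdf_ge0 x : 0 <= laguerre_pdf a x.
Proof.
by rewrite /laguerre_pdf !(mulr_ge0, invr_ge0, powR_ge0, Gamma_ge0, expR_ge0).
Qed.

HB.instance Definition _ := isMeasure.Build _ _ _ (laguerre_measure a)
  (density_measure0 (laguerre_pdf a)) (density_measure_ge0 laguerre_pdf_ge0)
  (density_measure_sigma_additive measurable_laguerre_pdf laguerre_pdf_ge0).

End measures.

(* Rodrigues' formulas. As powR takes arbitrary values at negative reals, the
   Jacobi and Laguerre ones give the polynomials on (-1, 1) and (0, +oo) only,
   i.e., almost everywhere for the corresponding measures. *)
Definition jacobi_poly {R : realType} (n : nat) (a b x : R) : R :=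
  (-1) ^+ n / (2 ^+ n * n`!%:R) * (1 - x) `^ (- a) * (1 + x) `^ (- b) *
  (fun y : R => (1 - y) `^ (n%:R + a) * (1 + y) `^ (n%:R + b))^`(n)%classic x.

Definition hermite_poly {R : realType} (n : nat) (x : R) : R :=
  (-1) ^+ n * expR (x ^+ 2) * (fun y : R => expR (- y ^+ 2))^`(n)%classic x.

Definition laguerre_poly {R : realType} (n : nat) (a x : R) : R :=
  (n`!%:R)^-1 * x `^ (- a) * expR x *
  (fun y : R => expR (- y) * y `^ (n%:R + a))^`(n)%classic x.

Section L2.
Context {R : realType}.
Variable mu : {measure set (measurableTypeR R) -> \bar R}.

Definition L2_inner (f g : R -> R) : R := \int[mu]_x (f x * g x).

Definition L2_norm (f : R -> R) : \bar R := 'N[mu]_2%:E [EFin \o f]%E.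

Definition is_L2_sum (u : nat -> R -> R) (g : R -> R) : Prop :=
  g \in Lfun mu 2%:E /\
  L2_norm (fun x => \sum_(1 <= k < n.+1) u k x - g x) @[n --> \oo] --> 0%E.

(* The sum over k >= 1 of u k in L^2(mu), determined up to mu-a.e. equality.
   The default value is irrelevant to the Riesz transforms: by orthogonality
   and Bessel's inequality their series converge for every f in L^2(mu). *)
Definition L2_sum (u : nat -> R -> R) : R -> R :=
  xget (cst 0) [set g : R -> R | is_L2_sum u g].

End L2.

Definition jacobi_sqnorm {R : realType} (a b : R) (n : nat) : R :=
  fine (L2_norm (jacobi_measure a b) (jacobi_poly n a b)) ^+ 2.

Definition jacobi_eigenvalue {R : realType} (a b : R) (k : nat) : R :=
  k%:R * (k%:R + a + b + 1).

Definition jacobi_riesz {R : realType} (a b : R) (f : R -> R) : R -> R :=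
  L2_sum (jacobi_measure a b) (fun k x =>
    L2_inner (jacobi_measure a b) f (jacobi_poly k a b) / jacobi_sqnorm a b k *
    (Num.sqrt (jacobi_eigenvalue a b k))^-1 * ((k%:R + a + b + 1) / 2) *
    Num.sqrt (1 - x ^+ 2) * jacobi_poly k.-1 (a + 1) (b + 1) x).

Definition gauss_riesz {R : realType} (f : R -> R) : R -> R :=
  L2_sum (gauss_measure R) (fun k x =>
    L2_inner (gauss_measure R) f (hermite_poly k) / (2 ^+ k * k`!%:R) *
    Num.sqrt (2 * k%:R) * hermite_poly k.-1 x).

Definition laguerre_riesz {R : realType} (a : R) (f : R -> R) : R -> R :=
  L2_sum (laguerre_measure a) (fun k x =>
    - (Gamma (a + 1) * k`!%:R / Gamma (k%:R + a + 1) * (Num.sqrt k%:R)^-1 *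
       L2_inner (laguerre_measure a) f (laguerre_poly k a) *
       Num.sqrt x * laguerre_poly k.-1 (a + 1) x)).

(* Main.v *)
Require Import Defs.
From HB Require Import structures.
From mathcomp Require Import all_boot all_order all_algebra.
From mathcomp Require Import all_classical all_reals all_analysis.
From mathcomp Require Import measurable_realfun.
From mathcomp Require Import ring lra.

Set Implicit Arguments.
Unset Strict Implicit.
Unset Printing Implicit Defensive.
Import Order.TTheory GRing.Theory Num.Theory.
Import numFieldNormedType.Exports.

Local Open Scope classical_set_scope.
Local Open Scope ring_scope.

(* Each of the three Riesz transforms maps an orthogonal family to an orthogonal
   family, and its multipliers are exactly the ratios of the norms; so it is
   a contraction, by Bessel's inequality, and the Gaussian and Laguerre bounds
   hold with constant 1. It remains to see that C2 >= 1: for a = b = 0 and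
   f(x) = x, the Legendre polynomial P_1, all the terms of R f but the first
   vanish and |R f| = |f|. No passage to the limit in the Jacobi parameters is
   used.

   The norms of the Hermite and Laguerre polynomials are obtained from Rodrigues'
   formula: D^n (w_n) = r_n w with r_n a polynomial, and integrating n times by
   parts, int p r_n w = (-1)^n int p^(n) w_n, which is 0 when deg p < n and only
   involves the leading coefficient of p when deg p = n. *)

(** * Bessel's inequality *)

(** The ratio of norms has one source. With d the derivation d/dx, sqrt(x) d/dx or sqrt(1 - x^2)
    d/dx, the transform sends the k-th polynomial P_k to d P_k divided by the square root of its
    eigenvalue, and integration by parts gives |d P_k|^2 = eigenvalue * |P_k|^2. So each P_k with k
    >= 1 keeps its norm, and already the first Legendre polynomial forces the constant to be at
    least 1. Two features of the encoding shape the proofs. A Riesz transform is some limit selected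
    by [xget]: an upper bound has to hold for every possible limit, whereas the lower bound on [C2]
    has to exhibit a limit and identify the selected one with it up to norm 0. And membership in
    [Lfun] asks for measurability on the whole line, so Rodrigues' formulas are also analysed where
    the density vanishes, where [powR] is constant on negative reals. *)

Section L2_theory.
Context {R : realType} (mu : {measure set (measurableTypeR R) -> \bar R}).
Implicit Types f g h : R -> R.
Local Notation L2 := (Lfun mu 2%:E).
Local Notation "''<' f , g >" := (L2_inner mu f g) (f, g at level 50).

Lemma Lfun2P f : measurable_fun [set: measurableTypeR R] f ->
  mu.-integrable setT (EFin \o (fun x => f x ^+ 2)) -> f \in L2.
Proof.
move=> mf /integrableP[_ foo]; rewrite inE; apply/andP; split; rewrite inE//=.
rewrite /finite_norm unlock /Lnorm poweR_lty//.
apply: le_lt_trans foo; rewrite le_eqVlt; apply/orP; left; apply/eqP.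
apply: eq_integral => x _ /=.
by rewrite powR_mulrn// -normrX.
Qed.

Lemma L2_measurable f : f \in L2 -> measurable_fun [set: measurableTypeR R] f.
Proof. by rewrite inE => /andP[]; rewrite inE. Qed.

Lemma L2_integrable f g : f \in L2 -> g \in L2 ->
  mu.-integrable setT (EFin \o (fun x => f x * g x)).
Proof. by move=> fL gL; apply/Lfun1_integrable; exact: Lfun2_mul_Lfun1. Qed.

Lemma L2_innerC f g : '<f, g> = '<g, f>.
Proof. by apply: eq_Rintegral => x _; rewrite mulrC. Qed.

Lemma L2_inner_ge0 f : 0 <= '<f, f>.
Proof. by apply: Rintegral_ge0 => x _; rewrite -expr2 sqr_ge0. Qed.

Lemma L2D f g : f \in L2 -> g \in L2 -> (fun x => f x + g x) \in L2.
Proof.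
have p1 : (1 <= 2%:E :> \bar R)%E by rewrite lee1n.
by move=> fL gL; have [_ H] := Lfun_addr_closed mu p1; exact: (H f g).
Qed.

Lemma L2Z c f : f \in L2 -> (fun x => c * f x) \in L2.
Proof.
move=> fL; rewrite (_ : (fun x => _) = c \o* f); last first.
  by apply/funext => x /=; rewrite mulrC.
by apply: Lfun_scale => //; rewrite ler1n.
Qed.

Lemma L2_cst0 : cst 0 \in L2.
Proof.
have p1 : (1 <= 2%:E :> \bar R)%E by rewrite lee1n.
by have [H _] := Lfun_addr_closed mu p1; exact: H.
Qed.

Lemma L2_bigsum (I : Type) (s : seq I) (F : I -> R -> R) :
  (forall i, F i \in L2) -> (fun x => \sum_(i <- s) F i x) \in L2.
Proof.
move=> FL; elim: s => [|i s ih].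
  by under eq_fun do rewrite big_nil; exact: L2_cst0.
by under eq_fun do rewrite big_cons; exact: L2D.
Qed.

Lemma L2_innerDl f g h : f \in L2 -> g \in L2 -> h \in L2 ->
  '<(fun x => f x + g x), h> = '<f, h> + '<g, h>.
Proof.
move=> fL gL hL; rewrite /L2_inner -RintegralD//; try exact: L2_integrable.
by apply: eq_Rintegral => x _; rewrite mulrDl.
Qed.

Lemma L2_innerZl c f g : f \in L2 -> g \in L2 ->
  '<(fun x => c * f x), g> = c * '<f, g>.
Proof.
move=> fL gL; rewrite /L2_inner -RintegralZl//; last exact: L2_integrable.
by apply: eq_Rintegral => x _; rewrite mulrA.
Qed.

Lemma L2_inner0l g : '<(cst 0), g> = 0.
Proof.
rewrite /L2_inner (@eq_Rintegral _ _ _ mu _ (cst 0))// ?Rintegral_cst// ?mul0r//.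
by move=> x _; rewrite /= mul0r.
Qed.

Lemma L2_inner_suml (I : Type) (s : seq I) (F : I -> R -> R) g :
  (forall i, F i \in L2) -> g \in L2 ->
  '<(fun x => \sum_(i <- s) F i x), g> = \sum_(i <- s) '<F i, g>.
Proof.
move=> FL gL; elim: s => [|i s ih].
  rewrite big_nil -[RHS](L2_inner0l g); congr L2_inner.
  by apply/funext => x; rewrite big_nil.
rewrite big_cons -ih -L2_innerDl//; last exact: L2_bigsum.
by congr L2_inner; apply/funext => x; rewrite big_cons.
Qed.

Lemma L2_normE f : f \in L2 -> L2_norm mu f = (Num.sqrt '<f, f>)%:E.
Proof.
move=> fL; rewrite /L2_norm unlock /Lnorm/=.
rewrite (@eq_integral _ _ _ mu _ (fun x => (f x * f x)%:E)); last first.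
  by move=> x _ /=; rewrite powR_mulrn// -normrX ger0_norm ?sqr_ge0.
have /integrable_fin_num : mu.-integrable setT (EFin \o (fun x => f x * f x)).
  exact: L2_integrable.
move=> /(_ measurableT)/fineK <- /=.
by rewrite -powR12_sqrt// L2_inner_ge0.
Qed.

Lemma L2_norm_ge0 f : (0 <= L2_norm mu f)%E.
Proof. exact: Lnorm_ge0. Qed.

Lemma L2_normBC f g :
  L2_norm mu (fun x => f x - g x) = L2_norm mu (fun x => g x - f x).
Proof.
rewrite /L2_norm -[LHS]oppe_Lnorm; apply: eq_Lnorm => x /=.
by rewrite opprB.
Qed.

Lemma L2_norm_le_normDB f g : f \in L2 -> g \in L2 ->
  (L2_norm mu f <= L2_norm mu g + L2_norm mu (fun x => f x - g x)%R)%E.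
Proof.
move=> fL gL.
have fgL : (fun x => f x - g x) \in L2.
  by under eq_fun do rewrite -mulN1r; apply: L2D => //; exact: L2Z.
apply: le_trans (minkowski_EFin mu _ _ _) => //.
- by rewrite le_eqVlt; apply/orP; left; apply/eqP; apply: eq_Lnorm => x /=; rewrite subrKC.
- exact: L2_measurable.
- exact: L2_measurable.
- by rewrite ler1n.
Qed.

Section bessel.
Variables (P : nat -> R -> R) (p : nat -> R).
Hypothesis PL : forall k, P k \in L2.
Hypothesis PP : forall k l, (0 < k)%N -> (0 < l)%N ->
  '<P k, P l> = (k == l)%:R * p k.

Lemma sqnorm_orthogonal_sum (c : nat -> R) n :
  '<(fun x => \sum_(1 <= k < n.+1) c k * P k x),
    (fun x => \sum_(1 <= k < n.+1) c k * P k x)> =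
  \sum_(1 <= k < n.+1) c k ^+ 2 * p k.
Proof.
have cPL k : (fun x => c k * P k x) \in L2 by exact: L2Z.
rewrite L2_inner_suml//; last exact: L2_bigsum.
apply: eq_big_nat => k /andP[k1 kn].
rewrite L2_innerC L2_inner_suml//.
rewrite (bigD1_seq k)/= ?mem_index_iota ?k1// ?iota_uniq//.
rewrite big1_seq ?addr0; last first.
  move=> l /andP[lk]; rewrite mem_index_iota => /andP[l1 _].
  rewrite L2_innerZl// L2_innerC L2_innerZl// PP//.
  by rewrite eq_sym (negbTE lk) mul0r !mulr0.
by rewrite L2_innerZl// L2_innerC L2_innerZl// PP// eqxx mul1r mulrA.
Qed.

(** Expand 0 <= |f - S|^2 for the orthogonal projection S of f: both <S, f> and <S, S> equal the sum
    on the left. The difference is written f + -1 * S so that the rules for sums and scalings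
    apply. *)
Lemma bessel_inequality f n : (forall k, 0 < p k) -> f \in L2 ->
  \sum_(1 <= k < n.+1) '<f, P k> ^+ 2 / p k <= '<f, f>.
Proof.
move=> p0 fL; pose c k := '<f, P k> / p k.
set S := fun x => \sum_(1 <= k < n.+1) c k * P k x.
have cPL k : (fun x => c k * P k x) \in L2 by exact: L2Z.
have SL : S \in L2 by exact: L2_bigsum.
have NSL : (fun x => -1 * S x) \in L2 by exact: L2Z.
have fS : '<S, f> = \sum_(1 <= k < n.+1) '<f, P k> ^+ 2 / p k.
  rewrite L2_inner_suml//; apply: eq_big_nat => k _.
  by rewrite L2_innerZl// L2_innerC /c expr2 mulrAC.
have SS : '<S, S> = \sum_(1 <= k < n.+1) '<f, P k> ^+ 2 / p k.
  rewrite sqnorm_orthogonal_sum; apply: eq_big_nat => k _.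
  by rewrite /c; field; rewrite gt_eqF.
have NS g : g \in L2 -> '<(fun x => -1 * S x), g> = - '<S, g>.
  by move=> gL; rewrite L2_innerZl// mulN1r.
have := L2_inner_ge0 (fun x => f x + -1 * S x).
rewrite L2_innerDl//; last exact: L2D.
rewrite NS; last exact: L2D.
rewrite (L2_innerC f) (L2_innerC S) !L2_innerDl// !NS// fS SS.
by rewrite (L2_innerC f S) fS; lra.
Qed.

End bessel.

(* A series whose terms are mutually orthogonal with square norms
   <f, P_k>^2 / |P_k|^2 is a contraction of f, by Bessel's inequality. *)
Lemma L2_sum_contraction (P Q : nat -> R -> R) (p q c : nat -> R) f :
  (forall k, P k \in L2) ->
  (forall k l, (0 < k)%N -> (0 < l)%N -> '<P k, P l> = (k == l)%:R * p k) ->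
  (forall k, 0 < p k) ->
  (forall k, Q k \in L2) ->
  (forall k l, (0 < k)%N -> (0 < l)%N -> '<Q k, Q l> = (k == l)%:R * q k) ->
  (forall k, (0 < k)%N -> c k ^+ 2 * q k = (p k)^-1) ->
  f \in L2 ->
  (L2_norm mu (L2_sum mu (fun k x => '<f, P k> * c k * Q k x)%R) <= L2_norm mu f)%E.
Proof.
move=> PL PP p0 QL QQ cq fL.
(* The bound is proved for an arbitrary limit [g]; if there is no limit, the value is [cst 0], of
   norm 0. *)
rewrite /L2_sum; case: xgetP => [g _ [gL]|_]; last first.
  by rewrite {1}/L2_norm Lnorm0 ?L2_norm_ge0// eqe.
pose b k := '<f, P k> * c k.
set S := fun n x => \sum_(1 <= k < n.+1) b k * Q k x.
have SL n : S n \in L2 by apply: L2_bigsum => k; exact: L2Z.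
have Sf n : (L2_norm mu (S n) <= L2_norm mu f)%E.
  rewrite !L2_normE// lee_fin; apply: ler_wsqrtr.
  rewrite (sqnorm_orthogonal_sum QL QQ).
  apply: le_trans (bessel_inequality PL PP n p0 fL).
  rewrite le_eqVlt; apply/orP; left; apply/eqP.
  apply: eq_big_nat => k /andP[k1 _].
  by rewrite exprMn -mulrA cq.
move=> Sg; rewrite -[leRHS]adde0.
(* |g| <= |S n| + |S n - g| <= |f| + o(1); finiteness of |f| lets the extended sum pass to the
   limit. *)
have fin : L2_norm mu f \is a fin_num by rewrite L2_normE.
have Sf_cvg : (L2_norm mu f + L2_norm mu (fun x => (S n x - g x)%R) @[n --> \oo]
    --> L2_norm mu f + 0)%E.
  by apply: cvgeD; [rewrite fin_num_adde_defl|exact: cvg_cst|exact: Sg].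
apply: (cvge_ge _ Sf_cvg).
apply: nearW => n; apply: (le_trans (L2_norm_le_normDB gL (SL n))).
rewrite L2_normBC.
exact: leeD.
Qed.

End L2_theory.

(** * Integration against a density *)

Section density.
Import HBNNSimple.
Context {R : realType} (nu : {measure set (measurableTypeR R) -> \bar R}).
Variable w : R -> R.
Hypothesis mw : measurable_fun [set: measurableTypeR R] w.
Hypothesis w0 : forall x, 0 <= w x.
(** [nu] is kept abstract so that the section applies to the Jacobi, Gaussian and Laguerre measures,
    each of which satisfies this equation by definition. *)
Hypothesis nuE : forall V, measurable V ->
  nu V = density_measure w V.
Local Notation leb := (@lebesgue_measure R).

Let mwE : measurable_fun [set: measurableTypeR R] (EFin \o w).
Proof. exact/measurable_EFinP. Qed.

Let integral_density_nnsfun (h : {nnsfun measurableTypeR R >-> R}) :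
  (\int[nu]_x (h x)%:E = \int[leb]_x ((h x)%:E * (w x)%:E))%E.
Proof.
have hE x : ((h x)%:E = \sum_(y \in range h) (y * \1_(h @^-1` [set y]) x)%:E)%E.
  by rewrite fimfunE -fsumEFin.
have mind y : measurable_fun [set: measurableTypeR R]
    (fun x => (y * \1_(h @^-1` [set y]) x)%:E).
  by apply/measurable_EFinP; apply: measurable_funM => //; exact: measurable_indic.
rewrite (@eq_integral _ _ _ nu _ _ _ (fun x _ => hE x)).
rewrite ge0_integral_fsum//; last by move=> y x _; exact: nnfun_muleindic_ge0.
rewrite (@eq_integral _ _ _ leb _ (fun x => \sum_(y \in range h)
    ((y * \1_(h @^-1` [set y]) x)%:E * (w x)%:E))%E); last first.
  move=> x _; rewrite hE ge0_mule_fsuml// => y.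
  exact: nnfun_muleindic_ge0.
rewrite ge0_integral_fsum//; last 2 first.
- by move=> y; apply: emeasurable_funM.
- by move=> y x _; rewrite mule_ge0// ?lee_fin//; exact: nnfun_muleindic_ge0.
apply: eq_fsbigr => y /[!inE] -[z _ hz].
have y0 : 0 <= y by rewrite -hz.
have my : measurable (h @^-1` [set y]) by [].
under eq_integral do rewrite EFinM.
rewrite ge0_integralZl//; last first.
  by apply/measurable_EFinP; exact: measurable_indic.
rewrite integral_indic// setIT nuE// /density_measure.
under [RHS]eq_integral do rewrite EFinM -muleA.
rewrite ge0_integralZl//; last 2 first.
- by apply: emeasurable_funM => //; apply/measurable_EFinP; exact: measurable_indic.
- by move=> x _; rewrite mule_ge0 ?lee_fin// indicE ler0n.
congr (_ * _)%E; rewrite [LHS]integral_mkcond; apply: eq_integral => x _.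
by rewrite epatch_indic/= muleC.
Qed.

Lemma ge0_integral_density (f : R -> \bar R) :
  measurable_fun [set: measurableTypeR R] f -> (forall x, 0 <= f x)%E ->
  (\int[nu]_x f x = \int[leb]_x (f x * (w x)%:E))%E.
Proof.
move=> mf f0; pose h := nnsfun_approx measurableT mf.
have hf x : (h n x)%:E @[n --> \oo] --> f x.
  by apply: cvg_nnsfun_approx => // *; exact: f0.
have nd_h x : {homo (fun n => h n x) : a b / (a <= b)%N >-> a <= b}.
  by move=> a b ab; exact/lefP/nd_nnsfun_approx.
have mh n : measurable_fun [set: measurableTypeR R] (fun x => (h n x)%:E).
  by apply/measurable_EFinP; exact/measurable_funP.
have -> : (\int[nu]_x f x = limn (fun n => \int[nu]_x (h n x)%:E))%E.
  rewrite (@eq_integral _ _ _ nu _ (fun x => limn (fun n => (h n x)%:E))).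
    apply: monotone_convergence => //.
    - by move=> n x _; rewrite lee_fin.
    - by move=> x _ a b ab; rewrite lee_fin nd_h.
  by move=> x _; apply/esym/cvg_lim => //; exact: hf.
rewrite (@eq_integral _ _ _ leb _
    (fun x => limn (fun n => (h n x)%:E * (w x)%:E)%E)); last first.
  by move=> x _; apply/esym/cvg_lim => //; apply: cvgeZr => //; exact: hf.
rewrite [RHS]monotone_convergence//; last 3 first.
- by move=> n; exact: emeasurable_funM.
- by move=> n x _; rewrite mule_ge0// lee_fin.
- by move=> x _ a b ab; rewrite lee_wpmul2r ?lee_fin ?nd_h.
by under eq_fun do rewrite integral_density_nnsfun.
Qed.

Lemma Rintegral_density (f : R -> R) :
  measurable_fun [set: measurableTypeR R] f ->
  \int[nu]_x f x = \int[leb]_x (f x * w x).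
Proof.
move=> mf; rewrite /Rintegral; congr fine.
have mfE : measurable_fun [set: measurableTypeR R] (EFin \o f) by exact/measurable_EFinP.
rewrite integralE [RHS]integralE.
rewrite !ge0_integral_density//; last 2 first.
- exact: measurable_funeneg.
- exact: measurable_funepos.
(* A nonnegative density commutes with taking positive and negative parts, so the two parts transfer
   separately. *)
have maxwE (x y : R) : 0 <= y -> (maxe x%:E 0 * y%:E = maxe (x * y)%:E 0)%E.
  by move=> y0; rewrite -[in LHS]EFin_max -EFinM -EFin_max maxr_pMl// mul0r.
congr (_ - _)%E; apply: eq_integral => x _.
- by rewrite !funeposE/= maxwE.
- by rewrite !funenegE/= maxwE// mulNr.
Qed.

Lemma integrable_density (f : R -> R) :
  measurable_fun [set: measurableTypeR R] f ->
  leb.-integrable setT (EFin \o (fun x => f x * w x)) ->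
  nu.-integrable setT (EFin \o f).
Proof.
move=> mf /integrableP[_ fw]; apply/integrableP; split.
  exact/measurable_EFinP.
rewrite ge0_integral_density//; last by do 2 apply: measurableT_comp => //.
rewrite (le_lt_trans _ fw)// le_eqVlt; apply/orP; left; apply/eqP.
by apply: eq_integral => x _ /=; rewrite normrM (ger0_norm (w0 x)).
Qed.

End density.

(** * Integrals of derivatives over increasing unions of segments *)

Section improper_FTC.
Context {R : realType}.
Local Notation leb := (@lebesgue_measure R).
Implicit Types (F f : R -> R) (D : set R).

Lemma FTC2_is_derive F f (a b : R) : a < b ->
  (forall x, a <= x <= b -> is_derive x 1 F (f x)) ->
  (forall x, a <= x <= b -> {for x, continuous f}) ->
  (\int[leb]_(x in `[a, b]) (f x)%:E = (F b - F a)%:E)%E.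
Proof.
move=> ab dF cf.
have cF x : a <= x <= b -> {for x, continuous F}.
  move=> xab; apply/differentiable_continuous/derivable1_diffP.
  by have [] := dF _ xab.
rewrite EFinB (@continuous_FTC2 _ _ F)//.
- apply: continuous_in_subspaceT => x; rewrite inE/= in_itv/=; exact: cf.
- split.
  + move=> x; rewrite in_itv/= => /andP[ax xb].
    by have [] := dF x; rewrite ?(ltW ax) ?(ltW xb).
  + by apply: cvg_at_right_filter; apply: cF; rewrite lexx ltW.
  + by apply: cvg_at_left_filter; apply: cF; rewrite lexx ltW.
- move=> x; rewrite in_itv/= => /andP[ax xb].
  by rewrite derive1E; apply: derive_val; apply: dF; rewrite !ltW.
Qed.

Section exhaustion.
Variables (D : set R) (a b : nat -> R) (F f : R -> R).
Hypothesis ab : forall n, a n < b n.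
Hypothesis nda : forall m n, (m <= n)%N -> a n <= a m.
Hypothesis ndb : forall m n, (m <= n)%N -> b m <= b n.
Hypothesis DE : \bigcup_n `[a n, b n]%classic = D.
Hypothesis dF : forall x, D x -> is_derive x 1 F (f x).
Hypothesis cf : forall x, D x -> {for x, continuous f}.

Let nd_itv m n : (m <= n)%N -> `[a m, b m] `<=` `[a n, b n].
Proof.
move=> mn x/=; rewrite !in_itv/= => /andP[amx xbm].
by rewrite (le_trans (nda mn) amx) (le_trans xbm (ndb mn)).
Qed.

Let itvD n : `[a n, b n] `<=` D.
Proof. by rewrite -DE => x xn; exists n. Qed.

Let mD : measurable D.
Proof. by rewrite -DE; exact: bigcup_measurable. Qed.

Let mf : measurable_fun D f.
Proof.
apply: subspace_continuous_measurable_fun => //.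
by apply: continuous_in_subspaceT => x /[!inE]; exact: cf.
Qed.

Let FTC_n n : (\int[leb]_(x in `[a n, b n]) (f x)%:E = (F (b n) - F (a n))%:E)%E.
Proof.
by apply: FTC2_is_derive => // x xab; [apply: dF|apply: cf]; apply: (@itvD n);
  rewrite /= in_itv.
Qed.

Lemma improper_FTC2 A B : leb.-integrable D (EFin \o f) ->
  F (a n) @[n --> \oo] --> A -> F (b n) @[n --> \oo] --> B ->
  \int[leb]_(x in D) f x = B - A.
Proof.
move=> fi FA FB; rewrite /Rintegral.
suff -> : (\int[leb]_(x in D) (f x)%:E = (B - A)%:E)%E by [].
(* Dominated convergence of the truncations of f to the n-th segment, with |f| as the bound; the
   truncated integrals are computed by [FTC_n]. *)
have int_cvg : (\int[leb]_(x in D) ((f \_ `[a n, b n]) x)%:E @[n --> \oo] -->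
    \int[leb]_(x in D) (f x)%:E)%E.
  apply: (@dominated_cvg _ _ _ leb _ mD _ _ (fun x => `|f x|%:E)).
  - move=> n; apply/measurable_EFinP; apply: measurable_funTS.
    apply/(measurable_restrictT _ _).1 => //.
    exact: measurable_funS (@itvD n) mf.
  - move=> x Dx; move: (Dx); rewrite -DE => -[N _ xN].
    apply: cvg_near_cst; near=> n.
    rewrite patchE ifT// inE; apply: nd_itv xN.
    by near: n; exact: nbhs_infty_ge.
  - by [].
  - exact: integrable_abse fi.
  - move=> n x Dx; rewrite patchE; case: ifPn => _ //=.
    by rewrite normr0 lee_fin.
apply: (cvg_unique _ int_cvg) => //.
rewrite (_ : (fun n => _) = (fun n => (F (b n) - F (a n))%:E)); last first.
  apply/funext => n; rewrite -FTC_n [RHS]integral_mkcond [LHS]integral_mkcond.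
  apply: eq_integral => x _; rewrite !patchE.
  case: ifPn => // xD; case: ifPn => //= xab.
  by move: xD; rewrite (mem_set (itvD (set_mem xab))).
apply: cvg_EFin; first exact: nearW.
exact: cvgB.
Unshelve. all: by end_near. Qed.

(** For a nonnegative f the integrals over the segments increase to the integral over [D], and each
    is an increment of F. A bounded primitive thus yields integrability. *)
Lemma ge0_FTC2_integrable (M : R) : (forall x, D x -> 0 <= f x) ->
  (forall n, F (b n) - F (a n) <= M) -> leb.-integrable D (EFin \o f).
Proof.
move=> f0 FM; apply/integrableP; split; first exact/measurable_EFinP.
apply: (@le_lt_trans _ _ M%:E); last exact: ltry.
under eq_integral => x /[!inE] Dx do rewrite /= ger0_norm ?f0//.
have int_cvg : (\int[leb]_(x in `[a n, b n]) (f x)%:E @[n --> \oo] -->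
    \int[leb]_(x in \bigcup_n `[a n, b n]%classic) (f x)%:E)%E.
  apply: ge0_nondecreasing_set_cvg_integral => //.
  - by move=> m n mn; apply/subsetPset; exact: nd_itv.
  - by move=> n; apply/measurable_EFinP; exact: measurable_funS (@itvD n) mf.
  - by move=> n x xab; rewrite lee_fin f0//; exact: itvD xab.
rewrite -DE; apply: (cvge_le _ int_cvg).
by apply: nearW => n; rewrite FTC_n lee_fin.
Qed.

End exhaustion.
End improper_FTC.

(** * The Gamma function *)

Section gamma.
Context {R : realType}.
Local Notation leb := (@lebesgue_measure R).
Implicit Types (s x : R).

(** The shift by 2 makes [lo n < hi n] strict already at n = 0, as the exhaustion by segments
    requires. *)
Let lo (n : nat) : R := n.+2%:R^-1.
Let hi (n : nat) : R := n.+2%:R.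

Let lo_hi n : lo n < hi n.
Proof.
by rewrite (@lt_trans _ _ 1)// ?ltr1n// invf_lt1// ltr1n.
Qed.

Let nd_lo m n : (m <= n)%N -> lo n <= lo m.
Proof. by move=> mn; rewrite lef_pV2 ?posrE// ler_nat !ltnS. Qed.

Let nd_hi m n : (m <= n)%N -> hi m <= hi n.
Proof. by move=> mn; rewrite ler_nat !ltnS. Qed.

Let bigcup_lo_hi : \bigcup_n `[lo n, hi n]%classic = `]0, +oo[%classic.
Proof.
apply/seteqP; split => [x [n _]|x]/=; rewrite !in_itv/= ?andbT.
  by move=> /andP[+ _]; apply: lt_le_trans; rewrite invr_gt0.
move=> x0; pose N := (Num.bound x + Num.bound x^-1)%N; exists N => //=.
have xN : x <= hi N.
  rewrite (le_trans (ltW (archi_boundP (ltW x0))))// ler_nat.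
  by rewrite /N -addn2 -addnA leq_addr.
have xVN : x^-1 <= hi N.
  have xV0 : 0 <= x^-1 by rewrite invr_ge0 ltW.
  rewrite (le_trans (ltW (archi_boundP xV0)))// ler_nat.
  by rewrite /N -addn2 addnAC leq_addl.
by rewrite in_itv/= xN andbT -[leRHS]invrK lef_pV2// ?posrE// invr_gt0.
Qed.

Let cvg_lo : lo n @[n --> \oo] --> 0.
Proof.
by have := @cvg_harmonic R; rewrite -(cvg_shiftS (@harmonic R : nat -> R^o)).
Qed.

Lemma expRN_le_inv x : 0 < x -> expR (- x) <= x^-1.
Proof.
move=> x0; rewrite expRN lef_pV2 ?posrE ?expR_gt0//.
by rewrite (le_trans _ (expR_ge1Dx x))// lerDr.
Qed.

Definition gamma_integrand s x : R := x `^ (s - 1) * expR (- x).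

Lemma measurable_gamma_integrand s :
  measurable_fun [set: measurableTypeR R] (gamma_integrand s).
Proof.
apply: measurable_funM; first exact: measurable_powR.
by apply: measurableT_comp.
Qed.

Lemma gamma_integrand_ge0 s x : 0 <= gamma_integrand s x.
Proof. by rewrite mulr_ge0 ?powR_ge0 ?expR_ge0. Qed.

Lemma powR_le_expR s : 0 < s ->
  exists2 K : R, 0 < K & forall x, 0 < x -> x `^ s <= K * expR (x / 2).
Proof.
(* The constant is (2s)^s: apply ln y < y to y = x / (2s) and multiply by s, which gives s ln x < x
   / 2 + s ln (2s). *)
move=> s0; exists (expR (s * ln (2 * s))); first exact: expR_gt0.
move=> x x0; rewrite -expRD /powR gt_eqF// ler_expR.
have s2 : 0 < 2 * s by rewrite mulr_gt0.
have y0 : 0 < x / (2 * s) by rewrite divr_gt0.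
have -> : ln x = ln (x / (2 * s)) + ln (2 * s).
  by rewrite -lnM ?posrE// divfK// gt_eqF.
have := ln_sublinear y0; rewrite -(ltr_pM2l s0).
have -> : s * (x / (2 * s)) = x / 2 by field; rewrite gt_eqF.
by rewrite mulrDr; lra.
Qed.

Lemma is_derive_powR1 s x : 0 < x ->
  is_derive x 1 (fun y => y `^ s) (s * x `^ (s - 1)).
Proof. by move=> x0; exact: is_derive1_powR. Qed.

Lemma continuous_powR_pos s x : 0 < x -> {for x, continuous (fun y : R => y `^ s)}.
Proof.
move=> x0; apply/differentiable_continuous/derivable1_diffP.
by have [] := is_derive_powR1 s x0.
Qed.

Lemma integrable_gamma s : 0 < s ->
  leb.-integrable `]0, +oo[ (EFin \o gamma_integrand s).
Proof.
move=> s0; have [K K0 xK] := powR_le_expR s0.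
(* F is bounded and its derivative f dominates a multiple of the integrand,
   both near 0 and near infinity. *)
pose F x : R := - (1 + x `^ s)^-1.
pose f x : R := s * x `^ (s - 1) / (1 + x `^ s) ^+ 2.
have den0 x : 0 < 1 + x `^ s by rewrite ltr_wpDr ?powR_ge0.
have fi : leb.-integrable `]0, +oo[ (EFin \o f).
  apply: (@ge0_FTC2_integrable _ _ lo hi F f _ _ _ _ _ _ 1) => //.
  - move=> x/=; rewrite in_itv/= andbT => x0.
    have d1 : is_derive x 1 (fun y : R => 1 + y `^ s) (0 + s * x `^ (s - 1)).
      exact: (is_deriveD (is_derive_cst _ _ _) (is_derive_powR1 s x0)).
    have dV := is_deriveN (@is_deriveV _ (fun y : R => 1 + y `^ s) _ _ _ (lt0r_neq0 (den0 x)) d1).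
    apply: (is_derive_eq dV).
    rewrite add0r -[_ *: _]/(- (1 + x `^ s) ^- 2 * (s * x `^ (s - 1))) /f.
    by field; rewrite gt_eqF.
  - move=> x/=; rewrite in_itv/= andbT => x0.
    apply: cvgM; first by apply: cvgM; [exact: cvg_cst|exact: continuous_powR_pos].
    apply: cvgV; first by rewrite gt_eqF// exprn_gt0.
    apply: (@continuous_comp _ _ _ (fun y => 1 + y `^ s) (fun y => y ^+ 2)).
      by apply: cvgD; [exact: cvg_cst|exact: continuous_powR_pos].
    exact: exprn_continuous.
  - move=> x _; rewrite mulr_ge0// ?mulr_ge0 ?powR_ge0 ?(ltW s0)//.
    by rewrite invr_ge0 exprn_ge0// ltW.
  - move=> n; rewrite /F opprK -[leRHS]add0r lerD//.
      by rewrite oppr_le0 invr_ge0 ltW.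
    by rewrite invf_le1// lerDl powR_ge0.
(* Since 1 + x^s <= (1 + K) e^(x/2), squaring gives e^(-x) <= (1 + K)^2 / (1 + x^s)^2; the division
   by s cancels the factor s of [f]. *)
pose C := (1 + K) ^+ 2 / s.
apply: (@le_integrable _ _ _ leb _ _ _ (fun x => C%:E * (EFin \o f) x)%E) => //.
- by apply/measurable_EFinP; apply: measurable_funTS; exact: measurable_gamma_integrand.
- move=> x/=; rewrite in_itv/= andbT => x0.
  rewrite lee_fin ger0_norm ?gamma_integrand_ge0//.
  have f0 : 0 <= C * f x.
    rewrite /C /f !(mulr_ge0, divr_ge0, exprn_ge0) ?invr_ge0 ?powR_ge0 ?addr_ge0 ?(ltW s0) ?(ltW K0)//.
    by rewrite exprn_ge0// ltW.
  rewrite ger0_norm//.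
  have -> : C * f x = x `^ (s - 1) * ((1 + K) ^+ 2 / (1 + x `^ s) ^+ 2).
    by rewrite /C /f; field; rewrite !gt_eqF.
  rewrite ler_wpM2l ?powR_ge0// ler_pdivlMr ?exprn_gt0//.
  rewrite expRN mulrC ler_pdivrMr ?expR_gt0//.
  have -> : expR x = expR (x / 2) ^+ 2 by rewrite -expRM_natl; congr expR; field.
  rewrite -exprMn lerXn2r ?nnegrE ?mulr_ge0 ?addr_ge0 ?powR_ge0 ?expR_ge0 ?(ltW K0)//.
  rewrite mulrDl lerD ?xK// mul1r.
  by rewrite -expR0 ler_expR divr_ge0// ltW.
- exact: integrableZl.
Qed.

(** A zero integral would make the integrand vanish almost everywhere, but it is positive on a
    half-line, which has infinite measure. *)
Lemma Gamma_gt0 s : 0 < s -> 0 < Gamma s.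
Proof.
move=> s0; rewrite lt_neqAle Gamma_ge0 andbT eq_sym; apply/eqP => G0.
have mg : measurable_fun (`]0, +oo[%classic : set (measurableTypeR R)) (EFin \o gamma_integrand s).
  by apply/measurable_EFinP; apply: measurable_funTS; exact: measurable_gamma_integrand.
have : (\int[leb]_(x in `]0%R, +oo[) `|(EFin \o gamma_integrand s) x| = 0)%E.
  under eq_integral do rewrite /= ger0_norm ?gamma_integrand_ge0//.
  have /integrable_fin_num/fineK <- := integrable_gamma s0; last by [].
  by congr (_%:E); exact: G0.
move=> /(ae_eq_integral_abs _ _ mg)[//|N [mN N0 DN]].
have : (leb `]0%R, +oo[%classic <= leb N)%E.
  apply: le_measure; rewrite ?inE//.
  move=> x x0; apply: DN => /(_ x0)/=.
  move: x0; rewrite /= in_itv/= andbT => x0 [] /eqP.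
  by rewrite mulf_eq0 !gt_eqF ?powR_gt0 ?expR_gt0.
by rewrite N0 lebesgue_measure_itv/= ltry.
Qed.

Lemma GammaD1 s : 0 < s -> Gamma (s + 1) = s * Gamma s.
Proof.
move=> s0.
have gi := integrable_gamma s0.
have gi1 : leb.-integrable `]0, +oo[ (EFin \o gamma_integrand (s + 1)).
  by apply: integrable_gamma; rewrite addr_gt0.
have sgi : leb.-integrable `]0, +oo[ (EFin \o (fun x => s * gamma_integrand s x)).
  exact: (integrableZl _ s gi).
pose F x : R := x `^ s * expR (- x).
pose f x : R := s * gamma_integrand s x - gamma_integrand (s + 1) x.
have : \int[leb]_(x in `]0, +oo[) f x = 0 - 0.
  apply: (@improper_FTC2 _ _ lo hi F f) => //.
  - move=> x/=; rewrite in_itv/= andbT => x0.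
    have dexp : is_derive x 1 (fun y : R => expR (- y)) (expR (- x) * - 1).
      exact: (is_derive1_comp (is_derive_expR _) (is_deriveNid _ _)).
    apply: (is_derive_eq (is_deriveM (is_derive_powR1 s x0) dexp)).
    rewrite /f /gamma_integrand addrK -![_ *: _]/(_ * _).
    by ring.
  - move=> x/=; rewrite in_itv/= andbT => x0.
    have cg t : {for x, continuous (gamma_integrand t)}.
      apply: cvgM; first exact: continuous_powR_pos.
      by apply: continuous_comp; [exact: opp_continuous|exact: continuous_expR].
    by apply: cvgB; [apply: cvgM; [exact: cvg_cst|exact: cg]|exact: cg].
  - exact: (integrableB _ sgi gi1).
  - apply: (@squeeze_cvgr _ _ _ _ (cst 0) (fun n => lo n `^ s)).
    + apply: nearW => n; rewrite mulr_ge0 ?powR_ge0 ?expR_ge0//=.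
      by rewrite ler_piMr ?powR_ge0// -expR0 ler_expR oppr_le0 invr_ge0.
    + exact: cvg_cst.
    + have := powR_cvg0 s0; move/cvg_at_rightP; apply; split.
        by move=> n; rewrite invr_gt0.
      exact: cvg_lo.
  (* At infinity, x^s e^(-x) <= K e^(-x/2) <= 2 K / x. *)
  - have [K K0 xK] := powR_le_expR s0.
    apply: (@squeeze_cvgr _ _ _ _ (cst 0) (fun n => K * (2 * lo n))).
    + apply: nearW => n; rewrite mulr_ge0 ?powR_ge0 ?expR_ge0//=.
      rewrite (le_trans (ler_wpM2r _ (xK _ _)))// ?expR_ge0//.
      rewrite -mulrA -expRD ler_wpM2l ?(ltW K0)//.
      rewrite (_ : _ + _ = - (hi n / 2)); last by field.
      by rewrite (le_trans (expRN_le_inv _)) ?divr_gt0// invf_div.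
    + exact: cvg_cst.
    + rewrite -[X in _ --> X](mulr0 K) -[X in K * X](mulr0 2).
      by do 2 (apply: cvgM; first exact: cvg_cst); exact: cvg_lo.
rewrite /f RintegralB// RintegralZl// subr0 => /eqP; rewrite subr_eq0 => /eqP.
by rewrite /Gamma /gamma_integrand => ->.
Qed.

End gamma.

(** * Iterated derivatives and piecewise measurability *)

Lemma derivn_size_leS (R : nzRingType) (p : {poly R}) n :
  (size p <= n.+1)%N -> p^`(n) = (p`_n *+ n`!)%:P.
Proof.
move=> pn; apply/polyP => -[|i]; rewrite coef_derivn coefC/=.
  by rewrite addn0 ffactnn.
by rewrite nth_default ?mul0rn// (leq_trans pn)// addnS ltnS leq_addr.
Qed.

Section derive1n.
Context {R : realType}.

(** Derivatives are local, so on an open set a guess [h] for the successive derivatives is enough,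
    whatever [powR] does elsewhere. *)
Lemma derive1n_on (U : set R) (f : R -> R) (h : nat -> R -> R) :
  open U -> (forall x, U x -> f x = h 0 x) ->
  (forall j x, U x -> is_derive x 1 (h j) (h j.+1 x)) ->
  forall n x, U x -> f^`(n)%classic x = h n x.
Proof.
move=> oU f0 dh; elim=> [|n ih] x Ux; first exact: f0.
rewrite derive1nS derive1E (@near_eq_derive _ _ _ _ (h n)).
  by apply: derive_val; exact: dh.
near=> y; apply: ih; near: y; exact: open_nbhs_nbhs.
Unshelve. all: by end_near. Qed.

(** Nothing is asked at [c] itself: there [powR] changes regime and the value of an iterated
    derivative is not known. *)
Lemma measurable_fun_split (c : R) (h h1 h2 : R -> R) :
  measurable_fun [set: measurableTypeR R] h1 ->
  measurable_fun [set: measurableTypeR R] h2 ->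
  (forall x, x < c -> h x = h1 x) -> (forall x, c < x -> h x = h2 x) ->
  measurable_fun [set: measurableTypeR R] h.
Proof.
move=> mh1 mh2 hh1 hh2.
have -> : h = (fun x => if x < c then h1 x else if c < x then h2 x else h c).
  apply/funext => x; case: ltgtP => [/hh1|/hh2|->]//.
apply: measurable_fun_ifT => //; first exact: measurable_fun_ltr.
by apply: measurable_fun_ifT => //; exact: measurable_fun_ltr.
Qed.

Lemma measurable_horner (p : {poly R}) : measurable_fun [set: measurableTypeR R] (horner p).
Proof. by apply: continuous_measurable_fun; exact: continuous_horner. Qed.

Lemma is_derive_expRN (x : R) : is_derive x 1 (fun y : R => expR (- y)) (- expR (- x)).
Proof.
apply: (is_derive_eq (is_derive1_comp (is_derive_expR _) (is_deriveNid _ _))).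
by rewrite mulrN1.
Qed.

End derive1n.

(** * Laguerre polynomials *)

Section gamma_moments.
Context {R : realType}.
Local Notation leb := (@lebesgue_measure R).
Implicit Types (p q r : {poly R}) (s x : R).

Definition gamma_moment s p : R :=
  \int[leb]_(x in `]0, +oo[) (p.[x] * gamma_integrand s x).

Lemma gamma_integrandM s x : 0 < s -> 0 < x ->
  x * gamma_integrand s x = gamma_integrand (s + 1) x.
Proof.
by move=> s0 x0; rewrite /gamma_integrand mulrA mulr_powRB1// ?addrK// ltW.
Qed.

Lemma integrable_gamma_moment s p : 0 < s ->
  leb.-integrable `]0, +oo[ (EFin \o (fun x => p.[x] * gamma_integrand s x)).
Proof.
elim/poly_ind: p s => [|p c ih] s s0.
  apply: eq_integrable (integrable0 _ _) => // x _.
  by rewrite /= horner0 mul0r.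
have h1 := ih (s + 1) (addr_gt0 s0 ltr01).
have h2 := integrableZl _ c (integrable_gamma s0).
have := integrableD _ h1 (h2 _); move=> /(_ _ _)/eq_integrable; apply => //.
move=> x; rewrite inE/= in_itv/= andbT => x0.
by rewrite hornerMXaddC mulrDl -mulrA gamma_integrandM.
Qed.

Lemma gamma_momentD s p q : 0 < s ->
  gamma_moment s (p + q) = gamma_moment s p + gamma_moment s q.
Proof.
move=> s0; rewrite /gamma_moment -RintegralD//; try exact: integrable_gamma_moment.
by apply: eq_Rintegral => x _; rewrite hornerD mulrDl.
Qed.

Lemma gamma_momentZ s c p : 0 < s ->
  gamma_moment s (c *: p) = c * gamma_moment s p.
Proof.
move=> s0; rewrite /gamma_moment -RintegralZl//; last exact: integrable_gamma_moment.
by apply: eq_Rintegral => x _; rewrite hornerZ -mulrA.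
Qed.

Lemma gamma_momentMX s p : 0 < s ->
  gamma_moment s (p * 'X) = gamma_moment (s + 1) p.
Proof.
move=> s0; apply: eq_Rintegral => x; rewrite inE/= in_itv/= andbT => x0.
by rewrite hornerMX -mulrA gamma_integrandM.
Qed.

Lemma gamma_moment1 s : gamma_moment s 1 = Gamma s.
Proof. by apply: eq_Rintegral => x _; rewrite hornerC mul1r. Qed.

(* x^(s-1) e^(-x) (laguerre_op s p)(x) is the derivative of x^s e^(-x) p(x). *)
Definition laguerre_op s p := 'X * p^`() + s *: p - 'X * p.

(** Integration by parts at the level of polynomials: the first term on the right has moment 0, and
    the factor ['X] of the second raises the parameter from s to s + 1. *)
Lemma laguerre_opM s p q :
  laguerre_op s p * q = laguerre_op s (p * q) - p * q^`() * 'X.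
Proof. by rewrite /laguerre_op derivM -!mul_polyC; ring. Qed.

(** By induction on p everything reduces to the functional equation of Gamma: a factor ['X] becomes
    a shift of s, and the constant c contributes c * (s * Gamma s - Gamma (s + 1)) = 0. *)
Lemma gamma_moment_laguerre_op s p : 0 < s -> gamma_moment s (laguerre_op s p) = 0.
Proof.
elim/poly_ind: p s => [|p c ih] s s0.
  rewrite /laguerre_op deriv0 !mulr0 scaler0 addr0 subr0.
  by rewrite -(scale0r 0) gamma_momentZ// mul0r.
have -> : laguerre_op s (p * 'X + c%:P) =
    laguerre_op (s + 1) p * 'X + ((s * c) *: 1 + (- c) *: (1 * 'X)).
  rewrite /laguerre_op derivD derivM derivX derivC -!mul_polyC.
  by rewrite !polyCM !polyCN !polyCD !polyC1; ring.
rewrite !gamma_momentD// !gamma_momentZ// !gamma_momentMX//.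
rewrite ih ?addr_gt0// !gamma_moment1 GammaD1//.
by ring.
Qed.

(* The polynomial part of D^n (x^(n+a) e^(-x)) = x^a e^(-x) r(x), i.e., n! times
   the n-th Laguerre polynomial. *)
Fixpoint laguerre_num n (a : R) : {poly R} :=
  if n is m.+1 then laguerre_op (a + 1) (laguerre_num m (a + 1)) else 1.

Lemma laguerre_num_lead n a :
  (size (laguerre_num n a) <= n.+1)%N /\ (laguerre_num n a)`_n = (-1) ^+ n.
Proof.
elim: n a => [|n ih] a; first by rewrite /= size_poly1 coef1.
have [sz ld] := ih (a + 1); set r := laguerre_num n (a + 1) in sz ld.
have r0 i : (n < i)%N -> r`_i = 0.
  by move=> ni; rewrite nth_default// (leq_trans sz).
have coefr i : (laguerre_num n.+1 a)`_i.+1 =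
    r`_i.+1 *+ i.+1 + (a + 1) * r`_i.+1 - r`_i.
  by rewrite /= /laguerre_op coefB coefD coefZ !coefXM/= coef_deriv.
split.
  apply/leq_sizeP => -[//|i] ni.
  by rewrite coefr !r0 ?mul0rn ?mulr0 ?addr0 ?subr0//; apply: ltnW.
by rewrite coefr r0// mul0rn mulr0 addr0 sub0r ld exprS mulN1r.
Qed.

Lemma gamma_moment_laguerre_num n a p : -1 < a ->
  gamma_moment (a + 1) (laguerre_num n a * p) =
  (-1) ^+ n * gamma_moment (a + 1 + n%:R) p^`(n).
Proof.
elim: n a p => [|n ih] a p a1; first by rewrite expr0 !mul1r addr0.
have a0 : 0 < a + 1 by lra.
rewrite /= laguerre_opM -scaleN1r gamma_momentD// gamma_momentZ//.
rewrite gamma_moment_laguerre_op// gamma_momentMX// ih; last by lra.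
rewrite -derivSn exprS -[in RHS]natr1 add0r mulrA (addrC n%:R) addrA.
by [].
Qed.

Lemma gamma_moment_orthogonal a k l : -1 < a ->
  gamma_moment (a + 1) (laguerre_num k a * laguerre_num l a) =
  (k == l)%:R * (k`!%:R * Gamma (a + 1 + k%:R)).
Proof.
(* By symmetry, the polynomial of lower degree can be the one that gets differentiated. *)
move=> a1; wlog : k l / (l <= k)%N => [hwlog|].
  case: (leqP l k) => [|/ltnW] lk; first exact: hwlog.
  rewrite mulrC hwlog// eq_sym; case: eqP => [->//|]; rewrite !mul0r//.
have ak : 0 < a + 1 + k%:R by rewrite ltr_wpDr// ?ler0n//; lra.
have [sz ld] := laguerre_num_lead l a.
rewrite gamma_moment_laguerre_num// leq_eqVlt => /predU1P[lk|lk].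
  rewrite -lk in ak *; rewrite derivn_size_leS// ld -[_%:P]mulr1 mul_polyC gamma_momentZ//.
  by rewrite gamma_moment1 eqxx !mul1r mulrA mulrnAr -expr2 sqrr_sign.
rewrite derivn_poly0 ?(leq_trans sz)// (gtn_eqF lk) mul0r.
by rewrite -(scale0r 0) gamma_momentZ// mul0r mulr0.
Qed.

End gamma_moments.

(** * The Laguerre-Riesz transform *)

Section laguerre_measure.
Context {R : realType}.
Local Notation leb := (@lebesgue_measure R).
Implicit Types (p q r : {poly R}) (s x a : R).

Lemma laguerre_polyE n a x : 0 < x ->
  laguerre_poly n a x = (n`!%:R)^-1 * (laguerre_num n a).[x].
Proof.
(* [h j] is the j-th derivative of e^(-y) y^(n + a): the exponent drops by one at each step, and
   reaches a at j = n. *)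
move=> x0; pose h j y : R :=
  expR (- y) * y `^ (n%:R + a - j%:R) * (laguerre_num j (n%:R + a - j%:R)).[y].
rewrite /laguerre_poly (_ : _^`(n)%classic x = h n x).
  rewrite /h addrAC subrr add0r.
  have xa : x `^ (- a) * x `^ a = 1.
    by rewrite -powRD ?addNr ?powRr0// (gt_eqF x0) implybT.
  transitivity ((n`!%:R)^-1 * (x `^ (- a) * x `^ a) * (expR x * expR (- x)) *
    (laguerre_num n a).[x]); first by ring.
  by rewrite xa expRxMexpNx_1 !mulr1.
apply: (@derive1n_on _ `]0, +oo[%classic).
- exact: interval_open.
- by move=> y _; rewrite /h subr0 hornerC mulr1.
- move=> j y; rewrite /= in_itv/= andbT => y0.
  set t := n%:R + a - j%:R; set r := laguerre_num j t.
  apply: (is_derive_eq (is_deriveM (is_deriveM (is_derive_expRN y)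
    (is_derive_powR1 t y0)) (is_derive_poly r y))).
  rewrite /h -/t -/r.
  rewrite -[((fun z : R => expR (- z)) * (fun z => z `^ t)) y]/(expR (- y) * y `^ t).
  have -> : n%:R + a - j.+1%:R = t - 1 by rewrite /t -natr1 opprD addrA.
  rewrite /= subrK -/r /laguerre_op !hornerE -![_ *: _]/(_ * _).
  have -> : y `^ t = y * y `^ (t - 1).
    by rewrite -{2}(powRr1 (ltW y0)) -powRD ?(gt_eqF y0) ?implybT// addrC subrK.
  by rewrite /= ; ring.
- by rewrite /= in_itv/= andbT.
Qed.

Lemma measurable_laguerre_poly n a :
  measurable_fun [set: measurableTypeR R] (laguerre_poly n a).
Proof.
(* y `^ (n + a) = 1 for y < 0 *)
apply: (@measurable_fun_split _ 0 _
  (fun x => (n`!%:R)^-1 * x `^ (- a) * expR x * ((-1) ^+ n * expR (- x)))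
  (fun x => (n`!%:R)^-1 * (laguerre_num n a).[x])).
- apply: measurable_funM.
    by apply: measurable_funM => //; apply: measurable_funM => //; exact: measurable_powR.
  by apply: measurable_funM => //; apply: measurableT_comp.
- by apply: measurable_funM => //; exact: measurable_horner.
- move=> x x0; rewrite /laguerre_poly; congr (_ * _).
  apply: (@derive1n_on _ `]-oo, 0[%classic _ (fun j x => (-1) ^+ j * expR (- x))).
  + exact: interval_open.
  + move=> y; rewrite /= in_itv/= => y0.
    by rewrite /powR lt_eqF// ln0 ?ltW// mulr0 expR0 mulr1 expr0 mul1r.
  + move=> j y _; apply: (is_derive_eq (is_deriveZ _ (is_derive_expRN y))).
    by rewrite -[_ *: _]/(_ * _) exprS; ring.
  + by rewrite /= in_itv.
- by move=> x x0; exact: laguerre_polyE.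
Qed.

Variable a : R.
Hypothesis a1 : -1 < a.
Local Notation mu := (laguerre_measure a).

Let a0 : 0 < a + 1. Proof. by rewrite -ltrBlDr sub0r. Qed.

Let laguerre_pdf_patch (f : R -> R) p : (forall x, 0 < x -> f x = p.[x]) ->
  (fun x => f x * laguerre_pdf a x) =
  (fun x => p.[x] * gamma_integrand (a + 1) x / Gamma (a + 1)) \_ `]0, +oo[.
Proof.
move=> fp; apply/funext => x; rewrite patchE /laguerre_pdf indicE.
case: ifPn => [|_]; last by rewrite mul0r mulr0.
rewrite inE/= in_itv/= andbT => x0; rewrite mul1r fp//.
by rewrite /gamma_integrand addrK mulrA.
Qed.

Lemma Rintegral_laguerre (f : R -> R) p :
  measurable_fun [set: measurableTypeR R] f -> (forall x, 0 < x -> f x = p.[x]) ->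
  \int[mu]_x f x = gamma_moment (a + 1) p / Gamma (a + 1).
Proof.
move=> mf fp; rewrite (Rintegral_density (measurable_laguerre_pdf a) (laguerre_pdf_ge0 a))//.
rewrite (laguerre_pdf_patch fp) -Rintegral_mkcond RintegralZr//.
exact: integrable_gamma_moment.
Qed.

Lemma integrable_laguerre (f : R -> R) p :
  measurable_fun [set: measurableTypeR R] f -> (forall x, 0 < x -> f x = p.[x]) ->
  mu.-integrable setT (EFin \o f).
Proof.
move=> mf fp; apply: (integrable_density (measurable_laguerre_pdf a) (laguerre_pdf_ge0 a)) => //.
rewrite (laguerre_pdf_patch fp) -restrict_EFin.
apply/integrable_restrict => //=; rewrite setTI.
exact: (integrableZr _ _ (integrable_gamma_moment p a0)).
Qed.

(** Only the square has to be polynomial, which covers the terms with a factor sqrt x. *)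
Lemma laguerre_Lfun (f : R -> R) p :
  measurable_fun [set: measurableTypeR R] f ->
  (forall x, 0 < x -> f x ^+ 2 = p.[x]) -> f \in Lfun mu 2%:E.
Proof.
move=> mf fp; apply: Lfun2P => //; apply: integrable_laguerre fp.
exact: measurable_funX.
Qed.

Lemma laguerre_riesz_contraction f : f \in Lfun mu 2%:E ->
  (L2_norm mu (laguerre_riesz a f) <= L2_norm mu f)%E.
Proof.
move=> fL.
pose P k := laguerre_poly k a.
pose Q k x : R := Num.sqrt x * laguerre_poly k.-1 (a + 1) x.
pose G k := Gamma (a + 1 + k%:R).
have G0 k : 0 < G k by apply: Gamma_gt0; rewrite ltr_wpDr.
(* [p] and [q] are the square norms of [P] and [Q]. For k >= 1, q k = k * p k and c k = - 1 / (p k *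
   sqrt k), whence c k ^ 2 * q k = 1 / p k. *)
pose p k := G k / (k`!%:R * Gamma (a + 1)).
pose q k := G k / ((k.-1)`!%:R * Gamma (a + 1)).
pose c k := - (Gamma (a + 1) * k`!%:R / Gamma (k%:R + a + 1) * (Num.sqrt k%:R)^-1).
have Ga0 := Gamma_gt0 a0.
have fact0 k : 0 < k`!%:R :> R by rewrite ltr0n fact_gt0.
have mQ k : measurable_fun [set: measurableTypeR R] (Q k).
  apply: measurable_funM; last exact: measurable_laguerre_poly.
  apply: continuous_measurable_fun; exact: sqrt_continuous.
(* The two factors sqrt x combine into ['X], which turns the weight of parameter a into that of
   parameter a + 1, for which these Laguerre polynomials are orthogonal. *)
have QE k l x : 0 < x -> Q k x * Q l x =
    ((k.-1)`!%:R^-1 / (l.-1)`!%:R *: ((laguerre_num k.-1 (a + 1) *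
      laguerre_num l.-1 (a + 1)) * 'X)).[x].
  move=> x0; rewrite hornerZ hornerMX hornerM /Q !laguerre_polyE//.
  by rewrite -[X in _ = _ * (_ * X)](sqr_sqrtr (ltW x0)) expr2; ring.
have PE k l x : 0 < x -> P k x * P l x =
    (k`!%:R^-1 / l`!%:R *: (laguerre_num k a * laguerre_num l a)).[x].
  move=> x0; rewrite hornerZ hornerM /P !laguerre_polyE//.
  by ring.
rewrite /laguerre_riesz.
rewrite (_ : (fun k x => _) = (fun k x => L2_inner mu f (P k) * c k * Q k x)); last first.
  by apply/funext => k; apply/funext => x; rewrite /c /Q /P; ring.
apply: (@L2_sum_contraction _ _ P Q p q c) => //.
- move=> k; apply: (@laguerre_Lfun _ _ (measurable_laguerre_poly k a)).
  exact: PE.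
- move=> k l _ _; rewrite /L2_inner (Rintegral_laguerre _ (PE k l)); last first.
    by apply: measurable_funM; exact: measurable_laguerre_poly.
  rewrite gamma_momentZ// gamma_moment_orthogonal//; case: eqP => [->|_].
    by rewrite /p -/(G l); field; rewrite !gt_eqF.
  by rewrite !mul0r mulr0 mul0r.
- by move=> k; rewrite divr_gt0// mulr_gt0.
- by move=> k; exact: (laguerre_Lfun (mQ k) (QE k k)).
- move=> [//|k] [//|l] _ _; rewrite /L2_inner (Rintegral_laguerre _ (QE _ _)); last first.
    exact: measurable_funM.
  rewrite gamma_momentZ// gamma_momentMX// gamma_moment_orthogonal//=; last first.
    by rewrite (lt_trans _ a0)// ltrN10.
  rewrite eqSS; case: eqP => [->|_]; last by rewrite !mul0r mulr0 mul0r.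
  rewrite (_ : a + 1 + 1 + l%:R = a + 1 + l.+1%:R); last by rewrite -natr1; ring.
  by rewrite /q -/(G l.+1); field; rewrite !gt_eqF.
- move=> [//|k] _; rewrite /c /p /q /=.
  rewrite (_ : k.+1%:R + a + 1 = a + 1 + k.+1%:R); last by ring.
  rewrite -/(G k.+1) sqrrN exprMn exprVn sqr_sqrtr ?ler0n// factS natrM.
  have k1 : 0 < 1 + k%:R :> R by rewrite nat1r ltr0n.
  by field; rewrite !gt_eqF.
Qed.

End laguerre_measure.

(** * Hermite polynomials *)

Section gauss_moments.
Context {R : realType}.
Local Notation leb := (@lebesgue_measure R).
Implicit Types (p q r : {poly R}) (s x a : R).

(** Induction on p, spending half of the exponent e on p and half on the extra factor x: with d = e
    / 2, |x| <= 1 + x^2 <= (1 + 1/d) e^(d x^2). *)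
Lemma horner_le_expR_sqr p e : 0 < e ->
  exists2 C : R, 0 <= C & forall x, `|p.[x]| <= C * expR (e * x ^+ 2).
Proof.
elim/poly_ind: p e => [|p c ih] e e0.
  by exists 0 => // x; rewrite horner0 normr0 mul0r.
have d0 : 0 < e / 2 by rewrite divr_gt0.
have [C C0 pC] := ih _ d0; set d := e / 2 in d0 pC.
have dV0 : 0 <= d^-1 by rewrite invr_ge0 ltW.
exists (C * (1 + d^-1) + `|c|); first by rewrite !addr_ge0// mulr_ge0// addr_ge0.
move=> x; set E := expR (d * x ^+ 2).
have E1 : 1 + d * x ^+ 2 <= E by exact: expR_ge1Dx.
have x20 : 0 <= x ^+ 2 by exact: sqr_ge0.
have dx0 : 0 <= d * x ^+ 2 by rewrite mulr_ge0// ltW.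
have E0 : 1 <= E by rewrite (le_trans _ E1)// lerDl.
have -> : expR (e * x ^+ 2) = E * E.
  by rewrite -expRD; congr expR; rewrite /d; field.
have xE : `|x| <= (1 + d^-1) * E.
  have x1 : `|x| <= 1 + x ^+ 2.
    rewrite -(real_normK (num_real x)).
    by have := sqr_ge0 (`|x| - 1); have := normr_ge0 x; nra.
  rewrite (le_trans x1)// mulrDl mul1r lerD// ler_pdivlMl//.
  by rewrite (le_trans _ E1)// lerDr.
rewrite hornerMXaddC (le_trans (ler_normD _ _))// mulrDl lerD//.
  rewrite normrM (le_trans (ler_pM _ _ (pC x) xE))//.
  by rewrite -/E le_eqVlt; apply/orP; left; apply/eqP; ring.
by rewrite ler_peMr// mulr_ege1.
Qed.

Lemma horner_gauss_le p :
  exists2 C : R, 0 <= C & forall x, `|p.[x] * gauss_fun x| <= C * expR (- (x ^+ 2 / 2)).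
Proof.
have h0 : 0 < 2^-1 :> R by rewrite invr_gt0.
have [C C0 pC] := horner_le_expR_sqr p h0; exists C => // x.
rewrite normrM (ger0_norm (gauss_fun_ge0 x)).
rewrite (le_trans (ler_wpM2r (gauss_fun_ge0 x) (pC x)))//.
rewrite -mulrA -expRD le_eqVlt; apply/orP; left; apply/eqP.
by congr (_ * expR _); field.
Qed.

Lemma measurable_horner_gauss p :
  measurable_fun [set: measurableTypeR R] (fun x => p.[x] * gauss_fun x).
Proof.
by apply: measurable_funM; [exact: measurable_horner|exact: measurable_gauss_fun].
Qed.

Lemma integrable_horner_gauss p :
  leb.-integrable setT (EFin \o (fun x => p.[x] * gauss_fun x)).
Proof.
have [C C0 pC] := horner_gauss_le p.
pose K : R := normal_peak 1.
have K0 : 0 < K by apply: normal_peak_gt0.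
(* The majorant C e^(-x^2/2) is a multiple of the standard normal density. *)
have Kn := integrableZl measurableT (C / K) (integrable_normal_pdf 0 (1 : R)).
apply: le_integrable Kn => //.
  by apply/measurable_EFinP; exact: measurable_horner_gauss.
move=> x _ /=; rewrite lee_fin.
rewrite /normal_pdf oner_eq0 /normal_fun.
rewrite (le_trans (pC x))// ger0_norm; last first.
  by rewrite mulr_ge0 ?divr_ge0 ?mulr_ge0 ?expR_ge0// ltW.
rewrite mulrA divfK ?gt_eqF//.
by rewrite subr0 expr1n mulNr.
Qed.

Definition gauss_moment p : R := \int[leb]_x (p.[x] * gauss_fun x).

Lemma gauss_momentD p q : gauss_moment (p + q) = gauss_moment p + gauss_moment q.
Proof.
rewrite /gauss_moment -RintegralD//; try exact: integrable_horner_gauss.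
by apply: eq_Rintegral => x _; rewrite hornerD mulrDl.
Qed.

Lemma gauss_momentZ c p : gauss_moment (c *: p) = c * gauss_moment p.
Proof.
rewrite /gauss_moment -RintegralZl//; last exact: integrable_horner_gauss.
by apply: eq_Rintegral => x _; rewrite hornerZ -mulrA.
Qed.

Lemma gauss_moment1 : gauss_moment 1 = Num.sqrt pi.
Proof.
rewrite /gauss_moment /Rintegral.
under eq_integral do rewrite hornerC mul1r.
by rewrite integralT_gauss.
Qed.

(* exp(-x^2) (hermite_op p)(x) is the derivative of exp(-x^2) p(x). *)
Definition hermite_op p := p^`() - 2 *: ('X * p).

Lemma is_derive_horner_gauss p x :
  is_derive x 1 (fun y => p.[y] * gauss_fun y) ((hermite_op p).[x] * gauss_fun x).
Proof.
have dsq : is_derive x 1 (fun y : R => - y ^+ 2) (- (2 * x)).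
  rewrite (_ : (fun y => - y ^+ 2) = horner (- 'X ^+ 2)); last first.
    by apply/funext => y; rewrite !hornerE.
  apply: (is_derive_eq (is_derive_poly _ x)).
  by rewrite derivN derivXn !hornerE mulr2n mulrDl mul1r.
apply: (is_derive_eq (is_deriveM (is_derive_poly p x)
  (is_derive1_comp (is_derive_expR _) dsq))).
rewrite /hermite_op !hornerE -![_ *: _]/(_ * _) /gauss_fun /=.
by ring.
Qed.

Lemma gauss_moment_hermite_op p : gauss_moment (hermite_op p) = 0.
Proof.
pose b (n : nat) : R := n.+1%:R.
have b0 n : 0 < b n by rewrite ltr0n.
pose F x := p.[x] * gauss_fun x.
have [C C0 pC] := horner_gauss_le p.
(* Treats both endpoints at once. The bound is C e^(-u^2/2) <= 2 C / u^2 <= 2 C / b n, the last step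
   because b n >= 1. *)
have cvgF (u : nat -> R) : (forall n, `|u n| = b n) -> F (u n) @[n --> \oo] --> 0.
  move=> ub; apply: (@norm_cvg0 _ _ _ _ _ _).
  apply: (@squeeze_cvgr _ _ _ _ (cst 0) (fun n => C * (2 * (b n)^-1))).
  - apply: nearW => n; rewrite normr_ge0/= (le_trans (pC _))// ler_wpM2l//.
    rewrite (le_trans (expRN_le_inv _))//.
      by rewrite divr_gt0// -(real_normK (num_real _)) ub exprn_gt0.
    rewrite invf_div ler_wpM2l// lef_pV2 ?posrE//.
      by rewrite -(real_normK (num_real _)) ub ler_eXnr// ler1n.
    by rewrite -(real_normK (num_real _)) ub exprn_gt0.
  - exact: cvg_cst.
  - rewrite -[X in _ --> X](mulr0 C) -[X in C * X](mulr0 2).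
    by do 2 (apply: cvgM; first exact: cvg_cst); exact: cvg_harmonic.
rewrite -(subr0 0).
apply: (@improper_FTC2 _ setT (fun n => - b n) b F) => //.
- by move=> n; rewrite (@lt_trans _ _ 0)// oppr_lt0.
- by move=> m n mn; rewrite lerN2 ler_nat ltnS.
- by move=> m n mn; rewrite ler_nat ltnS.
- apply/seteqP; split => // x _; exists (Num.bound `|x|) => //=.
  rewrite in_itv/= -ler_norml.
  by rewrite (le_trans (ltW (archi_boundP (normr_ge0 x))))// ler_nat.
- by move=> x _; exact: is_derive_horner_gauss.
- move=> x _; apply: cvgM; first exact: continuous_horner.
  exact: continuous_gauss_fun.
- exact: integrable_horner_gauss.
- by apply: cvgF => n; rewrite normrN gtr0_norm.
- by apply: cvgF => n; rewrite gtr0_norm.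
Qed.

Lemma hermite_opM p q : hermite_op p * q = hermite_op (p * q) - p * q^`().
Proof. by rewrite /hermite_op derivM -!mul_polyC; ring. Qed.

(* D^n exp(-x^2) = hermite_num n (x) exp(-x^2). *)
Definition hermite_num n : {poly R} := iter n hermite_op 1.

Lemma hermite_num_lead n :
  (size (hermite_num n) <= n.+1)%N /\ (hermite_num n)`_n = (- 2) ^+ n.
Proof.
elim: n => [|n [sz ld]]; first by rewrite /= size_poly1 coef1.
set r := hermite_num n in sz ld.
have r0 i : (n < i)%N -> r`_i = 0.
  by move=> ni; rewrite nth_default// (leq_trans sz).
have coefr i : (hermite_num n.+1)`_i.+1 = r`_i.+2 *+ i.+2 - 2 * r`_i.
  by rewrite /= /hermite_op coefB coefZ !coefXM/= coef_deriv.
split.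
  apply/leq_sizeP => -[//|i] ni.
  by rewrite coefr !r0 ?mul0rn ?mulr0 ?subr0//; do 2 apply: ltnW.
by rewrite coefr r0// mul0rn sub0r ld exprS mulNr.
Qed.

Lemma gauss_moment_hermite_num n p :
  gauss_moment (hermite_num n * p) = (-1) ^+ n * gauss_moment p^`(n).
Proof.
elim: n p => [|n ih] p; first by rewrite expr0 !mul1r.
rewrite /= hermite_opM -scaleN1r gauss_momentD gauss_momentZ.
by rewrite gauss_moment_hermite_op ih -derivSn exprS add0r mulrA.
Qed.

Lemma gauss_moment_orthogonal k l :
  gauss_moment (hermite_num k * hermite_num l) =
  (k == l)%:R * (2 ^+ k * k`!%:R * Num.sqrt pi).
Proof.
wlog : k l / (l <= k)%N => [hwlog|].
  case: (leqP l k) => [|/ltnW] lk; first exact: hwlog.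
  rewrite mulrC hwlog// eq_sym; case: eqP => [->//|]; rewrite !mul0r//.
have [sz ld] := hermite_num_lead l.
rewrite gauss_moment_hermite_num// leq_eqVlt => /predU1P[lk|lk].
  rewrite -lk derivn_size_leS// ld -[_%:P]mulr1 mul_polyC gauss_momentZ//.
  rewrite gauss_moment1 eqxx mul1r -[_ *+ _]mulr_natr !mulrA -exprMn.
  by rewrite mulN1r opprK.
rewrite derivn_poly0 ?(leq_trans sz)// (gtn_eqF lk) mul0r.
by rewrite -(scale0r 0) gauss_momentZ// mul0r mulr0.
Qed.

Lemma hermite_polyE n x : hermite_poly n x = ((-1) ^+ n *: hermite_num n).[x].
Proof.
rewrite /hermite_poly (_ : _^`(n)%classic x = (hermite_num n).[x] * gauss_fun x).
  rewrite hornerZ -mulrA; congr (_ * _).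
  by rewrite mulrCA /gauss_fun expRxMexpNx_1 mulr1.
apply: (@derive1n_on _ setT _ (fun j x => (hermite_num j).[x] * gauss_fun x)) => //.
- exact: openT.
- by move=> y _; rewrite hornerC mul1r.
- by move=> j y _; exact: is_derive_horner_gauss.
Qed.

Local Notation mu := (gauss_measure R).

Lemma Rintegral_gauss (f : R -> R) p : (forall x, f x = p.[x]) ->
  \int[mu]_x f x = gauss_moment p / Num.sqrt pi.
Proof.
move=> fp; rewrite (Rintegral_density measurable_gauss_pdf gauss_pdf_ge0)//; last first.
  by rewrite (_ : f = horner p); [exact: measurable_horner|exact/funext].
rewrite /gauss_moment -RintegralZr//; last exact: integrable_horner_gauss.
by apply: eq_Rintegral => x _; rewrite fp /gauss_pdf mulrA.
Qed.

Lemma gauss_Lfun p : horner p \in Lfun mu 2%:E.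
Proof.
apply: Lfun2P; first exact: measurable_horner.
apply: (integrable_density measurable_gauss_pdf gauss_pdf_ge0) => //.
  by apply: measurable_funX; exact: measurable_horner.
have := integrableZr measurableT (Num.sqrt (pi : R))^-1 (integrable_horner_gauss (p ^+ 2)).
apply: eq_integrable => // x _ /=.
by rewrite horner_exp /gauss_pdf -EFinM mulrA.
Qed.

Lemma gauss_riesz_contraction f : f \in Lfun mu 2%:E ->
  (L2_norm mu (gauss_riesz f) <= L2_norm mu f)%E.
Proof.
move=> fL.
pose P k := @hermite_poly R k.
pose Q k := @hermite_poly R k.-1.
(* [p] and [q] are the square norms of [P] and [Q], the latter being the same family shifted by one.
   As p k = 2 k * p k.-1 and c k = sqrt (2 k) / p k for k >= 1, c k ^ 2 * q k = 1 / p k. *)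
pose p k : R := 2 ^+ k * k`!%:R.
pose q k := p k.-1.
pose c k : R := (2 ^+ k * k`!%:R)^-1 * Num.sqrt (2 * k%:R).
have PE k : P k = horner ((-1) ^+ k *: hermite_num k).
  by apply/funext => x; exact: hermite_polyE.
have pi0 : 0 < Num.sqrt (pi : R) by rewrite sqrtr_gt0 pi_gt0.
have PP k l : L2_inner mu (P k) (P l) = (k == l)%:R * p k.
  have /Rintegral_gauss : forall x, P k x * P l x =
      ((-1) ^+ k * (-1) ^+ l *: (hermite_num k * hermite_num l)).[x].
    by move=> x; rewrite !PE !hornerZ hornerM; ring.
  rewrite /L2_inner => ->; rewrite gauss_momentZ gauss_moment_orthogonal.
  case: eqP => [->|_]; last by rewrite !mul0r mulr0 mul0r.
  by rewrite -expr2 sqrr_sign !mul1r mulfK ?gt_eqF.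
rewrite /gauss_riesz.
rewrite (_ : (fun k x => _) = (fun k x => L2_inner mu f (P k) * c k * Q k x)); last first.
  by apply/funext => k; apply/funext => x; rewrite /c /Q /P !mulrA.
apply: (@L2_sum_contraction _ _ P Q p q c) => //.
- by move=> k; rewrite PE; exact: gauss_Lfun.
- by move=> k; rewrite mulr_gt0 ?exprn_gt0// ltr0n fact_gt0.
- by move=> k; rewrite /Q -/(P _) PE; exact: gauss_Lfun.
- by move=> [//|k] [//|l] _ _; rewrite /q eqSS; exact: PP.
- move=> [//|k] _; rewrite /c /p /q /= exprMn sqr_sqrtr ?mulr_ge0 ?ler0n//.
  have k1 : 0 < 1 + k%:R :> R by rewrite nat1r ltr0n.
  have kf : 0 < k`!%:R :> R by rewrite ltr0n fact_gt0.
  rewrite /p factS natrM (exprS 2 k).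
  by field; rewrite !gt_eqF// exprn_gt0.
Qed.

End gauss_moments.

(** * The Legendre case a = b = 0 of the Jacobi-Riesz transform *)

Section legendre.
Context {R : realType}.
Local Notation leb := (@lebesgue_measure R).
Local Notation mu := (jacobi_measure (0 : R) 0).
Implicit Types (p q : {poly R}) (x : R).

Definition legendre_moment p : R := \int[leb]_(x in `]-1, 1[) p.[x].

Let itvN11 : -1 < 1 :> R. Proof. by rewrite (@lt_trans _ _ 0) ?ltrN10. Qed.

Lemma legendre_moment_deriv p : legendre_moment p^`() = p.[1] - p.[-1].
Proof.
rewrite /legendre_moment /Rintegral.
rewrite -(@integral_itv_bndoo _ _ _ _ true false); last first.
  by apply/measurable_EFinP; apply: measurable_funTS; exact: measurable_horner.
rewrite (@FTC2_is_derive _ (horner p))// => x _; last exact: continuous_horner.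
Qed.

Lemma integrable_legendre p : leb.-integrable `]-1, 1[ (EFin \o horner p).
Proof.
apply: (@integrableS _ _ _ leb `[-1, 1]%classic) => //.
  exact: subset_itv_oo_cc.
apply: continuous_compact_integrable; first exact: segment_compact.
by apply: continuous_subspaceT; exact: continuous_horner.
Qed.

Lemma legendre_momentZ c p : legendre_moment (c *: p) = c * legendre_moment p.
Proof.
rewrite /legendre_moment -RintegralZl//; last exact: integrable_legendre.
by apply: eq_Rintegral => x _; rewrite hornerZ.
Qed.

(** The normalizing factor of [jacobi_pdf 0 0], written in the same form so as to match it. It
    multiplies |f|^2 and |R f|^2 alike, so it enters only through its sign. *)
Definition legendre_const : R := Gamma (0 + 0 + 2) /
  (2 `^ (0 + 0 + 1) * Gamma (0 + 1) * Gamma (0 + 1)).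

Lemma legendre_const_gt0 : 0 < legendre_const.
Proof. by rewrite divr_gt0 ?mulr_gt0 ?powR_gt0 ?Gamma_gt0 ?add0r. Qed.

Let jacobi_pdf_patch (f : R -> R) p : (forall x, -1 < x < 1 -> f x = p.[x]) ->
  (fun x => f x * jacobi_pdf 0 0 x) =
  (fun x => p.[x] * legendre_const) \_ `]-1, 1[.
Proof.
move=> fp; apply/funext => x; rewrite patchE /jacobi_pdf indicE.
case: ifPn => [|_]; last by rewrite mul0r mulr0.
by rewrite inE/= in_itv/= => x1; rewrite mul1r fp// !powRr0 !mulr1.
Qed.

Lemma Rintegral_jacobi00 (f : R -> R) p :
  measurable_fun [set: measurableTypeR R] f -> (forall x, -1 < x < 1 -> f x = p.[x]) ->
  \int[mu]_x f x = legendre_moment p * legendre_const.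
Proof.
move=> mf fp; rewrite (Rintegral_density (measurable_jacobi_pdf 0 0) (jacobi_pdf_ge0 0 0))//.
rewrite (jacobi_pdf_patch fp) -Rintegral_mkcond RintegralZr//.
exact: integrable_legendre.
Qed.

Lemma jacobi00_Lfun (f : R -> R) p :
  measurable_fun [set: measurableTypeR R] f ->
  (forall x, -1 < x < 1 -> f x ^+ 2 = p.[x]) -> f \in Lfun mu 2%:E.
Proof.
move=> mf fp; apply: Lfun2P => //.
apply: (integrable_density (measurable_jacobi_pdf 0 0) (jacobi_pdf_ge0 0 0)) => //.
  exact: measurable_funX.
rewrite (jacobi_pdf_patch fp) -restrict_EFin.
apply/integrable_restrict => //=; rewrite setTI.
exact: (integrableZr _ _ (integrable_legendre p)).
Qed.

Let leg_base k : {poly R} := (1 - 'X ^+ 2) ^+ k.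

(** Each derivative lowers the order of vanishing by at most one; this makes the boundary terms at
    -1 and 1 vanish. *)
Lemma derivn_exp_factor (u : {poly R}) k j : (j <= k)%N ->
  exists q, (u ^+ k)^`(j) = u ^+ (k - j) * q.
Proof.
elim: j => [|j ih] jk; first by exists 1; rewrite subn0 mulr1.
have [q uq] := ih (ltnW jk).
exists (u^`() *+ (k - j) * q + u * q^`()).
rewrite derivnS uq derivM -(subnSK jk) deriv_exp/= -mulr_natr exprS.
by rewrite -(mulr_natr u^`()); ring.
Qed.

Let leg_base_endpoint k j x : (j < k)%N -> x ^+ 2 = 1 -> ((leg_base k)^`(j)).[x] = 0.
Proof.
move=> jk x1; have [q ->] := derivn_exp_factor (1 - 'X ^+ 2) (ltnW jk).
rewrite hornerM horner_exp !hornerE x1 subrr expr0n.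
by rewrite subn_eq0 leqNgt jk mul0r.
Qed.

(* X B^(k) is the derivative of X B^(k-1) - B^(k-2), which vanishes at -1 and 1
   for B = (1 - X^2)^k and k >= 2. *)
Lemma legendre_momentX_eq0 k : legendre_moment ('X * (leg_base k.+2)^`(k.+2)) = 0.
Proof.
have -> : 'X * (leg_base k.+2)^`(k.+2) =
    ('X * (leg_base k.+2)^`(k.+1) - (leg_base k.+2)^`(k))^`().
  by rewrite derivB derivM derivX -!derivnS mul1r addrAC subrr add0r.
rewrite legendre_moment_deriv !hornerE !leg_base_endpoint ?expr1n ?sqrrN ?expr1n//.
by rewrite !mulr0 !subrr.
Qed.

Let powR_lt0 x s : x < 0 -> x `^ s = 1.
Proof. by move=> x0; rewrite /powR lt_eqF// ln0 ?ltW// mulr0 expR0. Qed.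

Let derive1n_horner_on (U : set R) (f : R -> R) p n x :
  open U -> (forall y, U y -> f y = p.[y]) -> U x ->
  f^`(n)%classic x = p^`(n).[x].
Proof.
move=> oU fp; apply: (@derive1n_on _ U f (fun j => horner p^`(j))) => // j y _.
Qed.

Let rodrigues k (y : R) : R := (1 - y) `^ (k%:R + 0) * (1 + y) `^ (k%:R + 0).

Let rodrigues_mid k x : -1 < x < 1 ->
  (rodrigues k)^`(k)%classic x = (leg_base k)^`(k).[x].
Proof.
move=> x1; apply: (@derive1n_horner_on `]-1, 1[%classic).
- exact: interval_open.
- move=> y; rewrite /= in_itv/= => /andP[y1 y2].
  rewrite /rodrigues addr0 !powR_mulrn; [|lra|lra].
  by rewrite -exprMn horner_exp !hornerE; congr (_ ^+ _); ring.
- by rewrite /= in_itv.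
Qed.

Lemma jacobi_poly00E k x : -1 < x < 1 ->
  jacobi_poly k 0 0 x = ((-1) ^+ k / (2 ^+ k * k`!%:R) *: (leg_base k)^`(k)).[x].
Proof.
by move=> x1; rewrite /jacobi_poly oppr0 !powRr0 !mulr1 hornerZ -rodrigues_mid.
Qed.

Lemma measurable_jacobi_poly00 k :
  measurable_fun [set: measurableTypeR R] (jacobi_poly k (0 : R) 0).
Proof.
rewrite (_ : jacobi_poly _ _ _ = (fun x =>
    (-1) ^+ k / (2 ^+ k * k`!%:R) * (rodrigues k)^`(k)%classic x)); last first.
  by apply/funext => x; rewrite /jacobi_poly oppr0 !powRr0 !mulr1.
apply: measurable_funM => //.
set D := derive1n k _.
(* Since [powR] is 1 at negative reals, the function differentiated is (1 - y)^k left of -1, (1 -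
   y^2)^k in the middle and (1 + y)^k right of 1. Masking the left part allows one split at 1, then
   one at -1. *)
pose D' x := if x <= -1 then 0 else D x.
have mD' : measurable_fun [set: measurableTypeR R] D'.
  apply: (@measurable_fun_split _ 1 _
    (fun x => if x <= -1 then 0 else (leg_base k)^`(k).[x])
    (horner ((1 + 'X) ^+ k)^`(k))).
  - apply: measurable_fun_ifT => //; last exact: measurable_horner.
    exact: measurable_fun_ler.
  - exact: measurable_horner.
  - move=> x x1; rewrite /D'; case: ifPn => //; rewrite -ltNge => x2.
    by rewrite /D rodrigues_mid// x2.
  - move=> x x1; rewrite /D' leNgt (lt_trans itvN11 x1)/=.
    apply: (@derive1n_horner_on `]1, +oo[%classic).
    + exact: interval_open.
    + move=> y; rewrite /= in_itv/= andbT => y1.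
      rewrite /rodrigues addr0 powR_lt0 ?subr_lt0// mul1r powR_mulrn; last by lra.
      by rewrite horner_exp !hornerE.
    + by rewrite /= in_itv/= andbT.
apply: (@measurable_fun_split _ (-1) _ (horner ((1 - 'X) ^+ k)^`(k)) D') => //.
- exact: measurable_horner.
- move=> x x1; apply: (@derive1n_horner_on `]-oo, -1[%classic).
  + exact: interval_open.
  + move=> y; rewrite /= in_itv/= => y1.
    rewrite /rodrigues addr0 [X in _ * X]powR_lt0; last by lra.
    rewrite mulr1 powR_mulrn; last by lra.
    by rewrite horner_exp !hornerE.
  + by rewrite /= in_itv.
- by move=> x x1; rewrite /D' leNgt x1.
Qed.

(** * The test function f(x) = x *)

Let f x : R := x.
(** The common square norm of f, of P_1 and of the first term of R f: x^2 and (1 - x^2) / 2 both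
    have integral 2/3 over (-1, 1). *)
Let N := 2 / 3 * legendre_const.

Let N0 : 0 < N.
Proof. by rewrite /N mulr_gt0 ?legendre_const_gt0// divr_gt0. Qed.

Let mf : measurable_fun [set: measurableTypeR R] f.
Proof. exact: measurable_id. Qed.

Let jacobi_poly1 x : -1 < x < 1 -> jacobi_poly 1 0 0 x = x.
Proof.
move=> x1; rewrite jacobi_poly00E// /leg_base expr1 derivn1 derivB derivXn derivC.
by rewrite !hornerE; lra.
Qed.

Let deriv_cube : (3^-1 *: 'X ^+ 3 : {poly R})^`() = 'X ^+ 2.
Proof.
by rewrite derivZ derivXn -scalerMnr scalerMnl -mulr_natr mulVf ?pnatr_eq0// scale1r.
Qed.

Let legendre_momentX2 : legendre_moment ('X ^+ 2) = 2 / 3.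
Proof.
by rewrite -deriv_cube legendre_moment_deriv !hornerZ !hornerXn; field.
Qed.

Let inner_f_poly k : (0 < k)%N ->
  L2_inner mu f (jacobi_poly k 0 0) = (k == 1%N)%:R * N.
Proof.
move=> k0; rewrite /L2_inner (@Rintegral_jacobi00 _ ((-1) ^+ k / (2 ^+ k * k`!%:R) *:
    ('X * (leg_base k)^`(k)))); last 2 first.
- by apply: measurable_funM => //; exact: measurable_jacobi_poly00.
- by move=> x x1; rewrite jacobi_poly00E// !hornerZ hornerM hornerX mulrCA.
case: k k0 => [//|[|k]] _; last by rewrite legendre_momentZ legendre_momentX_eq0 mulr0 !mul0r.
rewrite eqxx mul1r /N -legendre_momentX2; congr (legendre_moment _ * _).
have -> : 'X * (leg_base 1)^`(1) = - ('X ^+ 2 *+ 2).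
  by rewrite /leg_base expr1 derivn1 derivB derivXn -polyC1 derivC; ring.
rewrite !expr1 mulr1 mulN1r scaleNr scalerN opprK -scalerMnr scalerMnl.
by rewrite -mulr_natr mulVf ?pnatr_eq0// scale1r.
Qed.

Let fL : f \in Lfun mu 2%:E.
Proof.
apply: (@jacobi00_Lfun _ ('X ^+ 2)) => // x _.
by rewrite /f hornerXn.
Qed.

Let inner_ff : L2_inner mu f f = N.
Proof.
rewrite /L2_inner (@Rintegral_jacobi00 _ ('X ^+ 2)) ?legendre_momentX2//.
  exact: measurable_funM.
by move=> x _; rewrite hornerXn expr2.
Qed.

Let P1L : jacobi_poly 1 0 0 \in Lfun mu 2%:E.
Proof.
apply: (@jacobi00_Lfun _ ('X ^+ 2)) => [|x x1]; first exact: measurable_jacobi_poly00.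
by rewrite jacobi_poly1// hornerXn.
Qed.

Let sqnorm1 : jacobi_sqnorm 0 0 1 = N.
Proof.
rewrite /jacobi_sqnorm L2_normE//= sqr_sqrtr ?L2_inner_ge0//.
rewrite /L2_inner (@Rintegral_jacobi00 _ ('X ^+ 2)) ?legendre_momentX2//.
  by apply: measurable_funM; exact: measurable_jacobi_poly00.
by move=> x x1; rewrite jacobi_poly1// hornerXn expr2.
Qed.

Let u k x := L2_inner mu f (jacobi_poly k 0 0) / jacobi_sqnorm 0 0 k *
  (Num.sqrt (jacobi_eigenvalue 0 0 k))^-1 * ((k%:R + 0 + 0 + 1) / 2) *
  Num.sqrt (1 - x ^+ 2) * jacobi_poly k.-1 (0 + 1) (0 + 1) x.

Let measurable_u1 : measurable_fun [set: measurableTypeR R] (u 1).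
Proof.
apply: measurable_funM.
  apply: measurable_funM => //.
  apply: (@measurableT_comp _ _ _ _ _ _ (@Num.sqrt R)).
    by apply: continuous_measurable_fun; exact: sqrt_continuous.
  by apply: measurable_funB => //; exact: measurable_funX.
apply: measurable_funM; first apply: measurable_funM; first apply: measurable_funM => //.
- by apply: measurableT_comp (measurable_powR _) _; exact: measurable_funB.
- by apply: measurableT_comp (measurable_powR _) _; exact: measurable_funD.
- apply: measurable_funM.
  + by apply: measurableT_comp (measurable_powR _) _; exact: measurable_funB.
  + by apply: measurableT_comp (measurable_powR _) _; exact: measurable_funD.
Qed.

Let u1E x : -1 < x < 1 -> u 1 x * u 1 x = (2^-1 *: (1 - 'X ^+ 2)).[x].
Proof.
move=> /andP[x1 x2].
have P0 : jacobi_poly 0 (0 + 1) (0 + 1) x = 1.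
  rewrite /jacobi_poly fact0 !expr0 mulr1 divr1 mul1r.
  rewrite derive1n0 !add0r !powRr1; [|lra|lra].
  rewrite !powR_inv1; [|lra|lra].
  by field; apply/andP; split; lra.
have x20 : 0 <= 1 - x ^+ 2 by nra.
(* For k = 1 the eigenvalue is 2 and the other coefficients are 1, so the term is sqrt ((1 - x^2) /
   2). *)
rewrite /u inner_f_poly// eqxx sqnorm1 mul1r divff ?gt_eqF// P0 mulr1.
rewrite /jacobi_eigenvalue !addr0 mul1r (_ : 1%:R + 1 = 2)//.
rewrite mul1r divff ?pnatr_eq0// mulr1.
rewrite mulrACA -!expr2 sqr_sqrtr// exprVn sqr_sqrtr// hornerZ.
by rewrite !hornerE.
Qed.

Let u1L : u 1 \in Lfun mu 2%:E.
Proof. by apply: (jacobi00_Lfun measurable_u1) => x x1; rewrite expr2; exact: u1E. Qed.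

Let inner_u1u1 : L2_inner mu (u 1) (u 1) = N.
Proof.
rewrite /L2_inner (@Rintegral_jacobi00 _ _ _ u1E); last exact: measurable_funM.
rewrite /N; congr (_ * _).
have -> : 2^-1 *: (1 - 'X ^+ 2) = (2^-1 *: ('X - 3^-1 *: 'X ^+ 3) : {poly R})^`().
  by rewrite derivZ derivB derivX deriv_cube.
by rewrite legendre_moment_deriv !hornerZ !hornerD !hornerN !hornerZ !hornerX !hornerXn; field.
Qed.

Lemma ge1_of_jacobi_bound (C : R) :
  (forall g : R -> R, g \in Lfun mu 2%:E ->
    (L2_norm mu (jacobi_riesz 0 0 g) <= C%:E * L2_norm mu g)%E) -> 1 <= C.
Proof.
move=> /(_ f fL); rewrite (L2_normE fL) inner_ff.
have Su n x : (0 < n)%N -> \sum_(1 <= k < n.+1) u k x = u 1 x.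
  move=> n0; rewrite big_ltn ?ltnS// big_nat_cond big1 ?addr0// => k.
  rewrite andbT => /andP[k1 _]; rewrite /u inner_f_poly ?(ltnW k1)//.
  by rewrite (gtn_eqF k1) !mul0r.
(* The partial sums are constant from n = 1 on, so the series has a limit and [xget] cannot fall
   back on its default. *)
have u_sum : is_L2_sum mu u (u 1).
  split=> //; apply: cvg_near_cst; near=> n.
  rewrite (_ : (fun x => _) = cst 0); first by rewrite /L2_norm Lnorm0// eqe.
  apply/funext => x; rewrite Su ?subrr//.
  by near: n; exact: nbhs_infty_gt.
rewrite /jacobi_riesz -/u /L2_sum.
case: xgetP => [g _ [gL ug]|noSum]; last by have := noSum _ u_sum.
(* The selected limit [g] may differ from [u 1] pointwise, but only by a function of norm 0, so |u
   1| <= |g| <= C |f|, where |u 1| = |f| > 0. *)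
have ug0 : L2_norm mu (fun x => u 1 x - g x) = 0%E.
  apply: (cvg_unique _ _ ug) => //; apply: cvg_near_cst; near=> n.
  congr (L2_norm mu); apply/funext => x; rewrite Su//.
  by near: n; exact: nbhs_infty_gt.
move=> gC; have := L2_norm_le_normDB u1L gL.
rewrite ug0 adde0 (L2_normE u1L) inner_u1u1 => /le_trans/(_ gC).
by rewrite -EFinM lee_fin ler_pMl// sqrtr_gt0.
Unshelve. all: by end_near. Qed.

End legendre.

Theorem theorem2p1 (R : realType) (C2 : R)
    (jacobi_bound : forall a b : R, -1 < a -> -1 < b ->
       forall f : R -> R, f \in Lfun (jacobi_measure a b) 2%:E ->
       (L2_norm (jacobi_measure a b) (jacobi_riesz a b f)
        <= C2%:E * L2_norm (jacobi_measure a b) f)%E) :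
  (forall f : R -> R, f \in Lfun (gauss_measure R) 2%:E ->
     (L2_norm (gauss_measure R) (gauss_riesz f)
      <= C2%:E * L2_norm (gauss_measure R) f)%E) /\
  (forall a : R, -1 < a ->
     forall f : R -> R, f \in Lfun (laguerre_measure a) 2%:E ->
     (L2_norm (laguerre_measure a) (laguerre_riesz a f)
      <= C2%:E * L2_norm (laguerre_measure a) f)%E).
Proof.
have C1 : 1 <= C2.
  by apply: ge1_of_jacobi_bound => f; apply: jacobi_bound; rewrite ltrN10.
have le_C2 (mu : {measure set (measurableTypeR R) -> \bar R}) f :
    (L2_norm mu f <= C2%:E * L2_norm mu f)%E.
  by rewrite -[leLHS]mul1e lee_wpmul2r ?lee_fin ?L2_norm_ge0.
split=> [f fL|a a1 f fL]; apply: le_trans (le_C2 _ _).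
- exact: gauss_riesz_contraction.
- exact: laguerre_riesz_contraction.
Qed.
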